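(* If a PDL formula $\varphi$ is valid, then for any label $x$ the sequent $\Rightarrow x:\varphi$ (empty antecedent) is derivable in $\mathbf{G3PDL}^{\omega}$.
   Context: PDL syntax: with countably many atomic propositions $p$ and atomic programs $a$, formulas and programs are given mutually by $\varphi,\psi ::= \bot \mid p \mid \varphi\wedge\psi \mid \varphi\vee\psi \mid \varphi\rightarrow\psi \mid [\alpha]\varphi$ and $\alpha,\beta ::= a \mid \alpha;\beta \mid \alpha\cup\beta \mid \varphi? \mid \alpha^{*}$, with the standard Kripke semantics: a model $\mathfrak m=(S,I)$ gives $I(p)\subseteq S$, $I(a)\subseteq S\times S$; $;$ is relational composition, $\cup$ union, $[\![\varphi?]\!]$ the identity on $[\![\varphi]\!]$, $[\![\alpha^*]\!]$ the reflexive–transitive closure of $[\![\alpha]\!]$, and $s\in[\![[\alpha]\varphi]\!]$ iff every $\alpha$-successor of $s$ is in $[\![\varphi]\!]$. A formula is valid if it holds at every state of every model. Labelled sequents: relational atoms $x\xrightarrow{a}y$ and labelled formulas $x:\varphi$ over a countable set of labels; a sequent $\Gamma\Rightarrow\Delta$ has finite sets $\Gamma,\Delta$ of these. Rules of $\mathbf{G3PDL}^{\infty}$ (premises / conclusion; ''$A,\Gamma$'' means $\{A\}\cup\Gamma$): (Ax) $A\Rightarrow A$; ($\bot$) $x:\bot\Rightarrow$; (WL) $\Gamma\Rightarrow\Delta$ / $A,\Gamma\Rightarrow\Delta$; (WR) $\Gamma\Rightarrow\Delta$ / $\Gamma\Rightarrow\Delta,A$; ($\wedge$L) $x:\varphi,x:\psi,\Gamma\Rightarrow\Delta$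 / $x:\varphi\wedge\psi,\Gamma\Rightarrow\Delta$; ($\wedge$R) $\Gamma\Rightarrow\Delta,x:\varphi$ and $\Gamma\Rightarrow\Delta,x:\psi$ / $\Gamma\Rightarrow\Delta,x:\varphi\wedge\psi$; ($\vee$L) $x:\varphi,\Gamma\Rightarrow\Delta$ and $x:\psi,\Gamma\Rightarrow\Delta$ / $x:\varphi\vee\psi,\Gamma\Rightarrow\Delta$; ($\vee$R) $\Gamma\Rightarrow\Delta,x:\varphi,x:\psi$ / $\Gamma\Rightarrow\Delta,x:\varphi\vee\psi$; ($\rightarrow$L) $\Gamma\Rightarrow\Delta,x:\varphi$ and $x:\psi,\Gamma\Rightarrow\Delta$ / $x:\varphi\rightarrow\psi,\Gamma\Rightarrow\Delta$; ($\rightarrow$R) $x:\varphi,\Gamma\Rightarrow\Delta,x:\psi$ / $\Gamma\Rightarrow\Delta,x:\varphi\rightarrow\psi$; ($\Box$L) $y:\varphi,\Gamma\Rightarrow\Delta$ / $x:[a]\varphi,x\xrightarrow{a}y,\Gamma\Rightarrow\Delta$; ($\Box$R) $x\xrightarrow{a}y,\Gamma\Rightarrow\Delta,y:\varphi$ / $\Gamma\Rightarrow\Delta,x:[a]\varphi$ with $y$ fresh; (;L/R) replace $x:[\alpha;\beta]\varphi$ by $x:[\alpha][\beta]\varphi$ on the same side; ($\cup$L) $x:[\alpha]\varphi,x:[\beta]\varphi,\Gamma\Rightarrow\Delta$ / $x:[\alpha\cup\beta]\varphi,\Gamma\Rightarrow\Delta$; ($\cup$R) $\Gamma\Rightarrow\Delta,x:[\alpha]\varphi$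 and $\Gamma\Rightarrow\Delta,x:[\beta]\varphi$ / $\Gamma\Rightarrow\Delta,x:[\alpha\cup\beta]\varphi$; (?L) $\Gamma\Rightarrow\Delta,x:\varphi$ and $x:\psi,\Gamma\Rightarrow\Delta$ / $x:[\varphi?]\psi,\Gamma\Rightarrow\Delta$; (?R) $x:\varphi,\Gamma\Rightarrow\Delta,x:\psi$ / $\Gamma\Rightarrow\Delta,x:[\varphi?]\psi$; ($*$L) $x:\varphi,x:[\alpha][\alpha^*]\varphi,\Gamma\Rightarrow\Delta$ / $x:[\alpha^*]\varphi,\Gamma\Rightarrow\Delta$; ($*$R) $\Gamma\Rightarrow\Delta,x:\varphi$ and $\Gamma\Rightarrow\Delta,x:[\alpha][\alpha^*]\varphi$ / $\Gamma\Rightarrow\Delta,x:[\alpha^*]\varphi$; (Subst) $\Gamma\Rightarrow\Delta$ / $\Gamma[x/y]\Rightarrow\Delta[x/y]$ (replace $x$ by $y$); (Cut) $\Gamma\Rightarrow\Delta,A$ and $A,\Sigma\Rightarrow\Pi$ / $\Gamma,\Sigma\Rightarrow\Delta,\Pi$. Trace values $\tau=(x,\alpha_1\cdots\alpha_n,\beta,\varphi)$ stand for $x:[\alpha_1]\cdots[\alpha_n][\beta^*]\varphi$ (spine $\alpha_1\cdots\alpha_n$); $[\gamma]\tau$ prepends $\gamma$ to the spine, $y:\tau$ changes the label. $(\tau,\tau')$ is a trace pair for conclusion $\Gamma\Rightarrow\Delta$ and premise $\Gamma'\Rightarrow\Delta'$ if $\tau\in\Delta,\tau'\in\Delta'$ and: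 if $\tau$ is principal then $\tau'$ is its immediate ancestor with, for ($\Box$R) $\tau=x:[a]\tau'$, for (?R) $\tau=[\varphi?]\tau'$, for (;R) $\tau=[\alpha;\beta]\tau''$, $\tau'=[\alpha][\beta]\tau''$, for ($\cup$R) $\tau=[\alpha\cup\beta]\tau''$ and $\tau'=[\alpha]\tau''$ resp. $[\beta]\tau''$ in left resp. right premise, for ($*$R) $\tau=[\alpha^*]\tau'$ (left premise) or $\tau'=[\alpha]\tau$ (right premise); if $\tau$ is not principal then $\tau'=\tau$, except under (Subst) where $\tau$ is $\tau'$ with the substitution applied to its label. It is progressing if $\tau$ is principal with empty spine. A trace follows an infinite path of sequents if from some point on its consecutive values form trace pairs along the path. A $\mathbf{G3PDL}^{\infty}$ proof is a possibly infinite derivation tree in which every infinite path is followed by a trace with infinitely many progressing pairs. A $\mathbf{G3PDL}^{\omega}$ proof is a finite derivation tree whose non-axiom leaves (buds) are each assigned an internal node (companion) with a syntactically identical sequent, such that its infinite unfolding is a $\mathbf{G3PDL}^{\infty}$ proof; a sequent is derivable in $\mathbf{G3PDL}^{\omega}$ if it has such a proof (instances of (Cut) are allowed). *)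

(* Defs.v *)
From HB Require Import structures.
From Stdlib Require Import Relation_Operators.
From mathcomp Require Import all_boot finmap.

Set Implicit Arguments.
Unset Strict Implicit.
Unset Printing Implicit Defensive.

Local Open Scope fset_scope.

(* Atomic propositions, atomic programs and labels are all indexed by [nat]. *)
Inductive formula : Type :=
| Bot
| Prp of nat
| And of formula & formula
| Or of formula & formula
| Imp of formula & formula
| Box of program & formula
with program : Type :=
| Atm of nat
| Seq of program & program
| Cup of program & program
| Test of formula
| Star of program.

(* Encoding into [GenTree.tree nat], only used to equip the syntax with
   decidable equality and choice, as required by [{fset _}]. *)
Fixpoint formula_code (f : formula) : GenTree.tree nat :=
  match f with
  | Bot => GenTree.Node 0 [::]
  | Prp n => GenTree.Node 1 [:: GenTree.Leaf n]
  | And f g => GenTree.Node 2 [:: formula_code f; formula_code g]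
  | Or f g => GenTree.Node 3 [:: formula_code f; formula_code g]
  | Imp f g => GenTree.Node 4 [:: formula_code f; formula_code g]
  | Box a f => GenTree.Node 5 [:: program_code a; formula_code f]
  end
with program_code (a : program) : GenTree.tree nat :=
  match a with
  | Atm n => GenTree.Node 0 [:: GenTree.Leaf n]
  | Seq a b => GenTree.Node 1 [:: program_code a; program_code b]
  | Cup a b => GenTree.Node 2 [:: program_code a; program_code b]
  | Test f => GenTree.Node 3 [:: formula_code f]
  | Star a => GenTree.Node 4 [:: program_code a]
  end.

Fixpoint formula_decode (t : GenTree.tree nat) : formula :=
  match t with
  | GenTree.Node 1 [:: GenTree.Leaf n] => Prp n
  | GenTree.Node 2 [:: t; u] => And (formula_decode t) (formula_decode u)
  | GenTree.Node 3 [:: t; u] => Or (formula_decode t) (formula_decode u)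
  | GenTree.Node 4 [:: t; u] => Imp (formula_decode t) (formula_decode u)
  | GenTree.Node 5 [:: t; u] => Box (program_decode t) (formula_decode u)
  | _ => Bot
  end
with program_decode (t : GenTree.tree nat) : program :=
  match t with
  | GenTree.Node 0 [:: GenTree.Leaf n] => Atm n
  | GenTree.Node 1 [:: t; u] => Seq (program_decode t) (program_decode u)
  | GenTree.Node 2 [:: t; u] => Cup (program_decode t) (program_decode u)
  | GenTree.Node 3 [:: t] => Test (formula_decode t)
  | GenTree.Node 4 [:: t] => Star (program_decode t)
  | _ => Atm 0
  end.

Fixpoint formula_codeK (f : formula) : formula_decode (formula_code f) = f
with program_codeK (a : program) : program_decode (program_code a) = a.
Proof.
- by case: f => //= [f g|f g|f g|a f]; rewrite ?formula_codeK ?program_codeK.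
- by case: a => //= [a b|a b|f|a]; rewrite ?formula_codeK ?program_codeK.
Qed.

HB.instance Definition _ := Countable.copy formula (can_type formula_codeK).
HB.instance Definition _ := Countable.copy program (can_type program_codeK).

Record model : Type := Model {
  state : Type;
  interp_prp : nat -> state -> Prop;
  interp_atm : nat -> state -> state -> Prop
}.

Fixpoint sat (M : model) (f : formula) (s : state M) {struct f} : Prop :=
  match f with
  | Bot => False
  | Prp p => interp_prp p s
  | And f g => sat f s /\ sat g s
  | Or f g => sat f s \/ sat g s
  | Imp f g => sat f s -> sat g s
  | Box a f => forall t, run a s t -> sat f t
  end
with run (M : model) (a : program) (s t : state M) {struct a} : Prop :=
  match a with
  | Atm n => interp_atm n s t
  | Seq a b => exists2 u, run a s u & run b u t
  | Cup a b => run a s t \/ run b s t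
  | Test f => s = t /\ sat f s
  | Star a => clos_refl_trans (state M) (@run M a) s t
  end.

Definition valid (f : formula) : Prop := forall (M : model) (s : state M), sat f s.

Inductive item : Type :=
| Rel of nat & nat & nat        (* [Rel x a y] is the relational atom x -a-> y *)
| Lab of nat & formula.         (* [Lab x f] is the labelled formula x : f *)

Definition item_code (A : item) : nat * nat * nat + nat * formula :=
  match A with Rel x a y => inl (x, a, y) | Lab x f => inr (x, f) end.
Definition item_decode (c : nat * nat * nat + nat * formula) : item :=
  match c with inl (x, a, y) => Rel x a y | inr (x, f) => Lab x f end.
Lemma item_codeK : cancel item_code item_decode. Proof. by case. Qed.
HB.instance Definition _ := Countable.copy item (can_type item_codeK).

(* (Γ, Δ) stands for Γ => Δ. *)
Definition sequent : Type := ({fset item} * {fset item})%type.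

Definition item_labels (A : item) : seq nat :=
  match A with Rel x _ y => [:: x; y] | Lab x _ => [:: x] end.

Definition fresh (y : nat) (G : {fset item}) : Prop :=
  forall A, A \in G -> y \notin item_labels A.

Definition subst_label (x y z : nat) : nat := if z == x then y else z.

Definition subst_item (x y : nat) (A : item) : item :=
  match A with
  | Rel z a w => Rel (subst_label x y z) a (subst_label x y w)
  | Lab z f => Lab (subst_label x y z) f
  end.

Definition subst_set (x y : nat) (G : {fset item}) : {fset item} :=
  [fset subst_item x y A | A in G].

(* The contexts G, D (and G', D' for the second premise of a cut) are arbitrary;
   since sequents are made of sets, they may already contain the principal
   item, so that contraction is built in. *)
Inductive rule : Type :=
| RAx of item
| RBot of nat
| RWL (A : item) (G D : {fset item})
| RWR (A : item) (G D : {fset item})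
| RAndL (x : nat) (f g : formula) (G D : {fset item})
| RAndR (x : nat) (f g : formula) (G D : {fset item})
| ROrL (x : nat) (f g : formula) (G D : {fset item})
| ROrR (x : nat) (f g : formula) (G D : {fset item})
| RImpL (x : nat) (f g : formula) (G D : {fset item})
| RImpR (x : nat) (f g : formula) (G D : {fset item})
| RBoxL (x a y : nat) (f : formula) (G D : {fset item})
| RBoxR (x a y : nat) (f : formula) (G D : {fset item})
| RSeqL (x : nat) (a b : program) (f : formula) (G D : {fset item})
| RSeqR (x : nat) (a b : program) (f : formula) (G D : {fset item})
| RCupL (x : nat) (a b : program) (f : formula) (G D : {fset item})
| RCupR (x : nat) (a b : program) (f : formula) (G D : {fset item})
| RTestL (x : nat) (f g : formula) (G D : {fset item})
| RTestR (x : nat) (f g : formula) (G D : {fset item})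
| RStarL (x : nat) (a : program) (f : formula) (G D : {fset item})
| RStarR (x : nat) (a : program) (f : formula) (G D : {fset item})
| RSubst (x y : nat) (G D : {fset item})
| RCut (A : item) (G D G' D' : {fset item}).

Definition concl (r : rule) : sequent :=
  match r with
  | RAx A => ([fset A], [fset A])
  | RBot x => ([fset Lab x Bot], fset0)
  | RWL A G D => (A |` G, D)
  | RWR A G D => (G, A |` D)
  | RAndL x f g G D => (Lab x (And f g) |` G, D)
  | RAndR x f g G D => (G, Lab x (And f g) |` D)
  | ROrL x f g G D => (Lab x (Or f g) |` G, D)
  | ROrR x f g G D => (G, Lab x (Or f g) |` D)
  | RImpL x f g G D => (Lab x (Imp f g) |` G, D)
  | RImpR x f g G D => (G, Lab x (Imp f g) |` D)
  | RBoxL x a y f G D => (Lab x (Box (Atm a) f) |` (Rel x a y |` G), D)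
  | RBoxR x a y f G D => (G, Lab x (Box (Atm a) f) |` D)
  | RSeqL x a b f G D => (Lab x (Box (Seq a b) f) |` G, D)
  | RSeqR x a b f G D => (G, Lab x (Box (Seq a b) f) |` D)
  | RCupL x a b f G D => (Lab x (Box (Cup a b) f) |` G, D)
  | RCupR x a b f G D => (G, Lab x (Box (Cup a b) f) |` D)
  | RTestL x f g G D => (Lab x (Box (Test f) g) |` G, D)
  | RTestR x f g G D => (G, Lab x (Box (Test f) g) |` D)
  | RStarL x a f G D => (Lab x (Box (Star a) f) |` G, D)
  | RStarR x a f G D => (G, Lab x (Box (Star a) f) |` D)
  | RSubst x y G D => (subst_set x y G, subst_set x y D)
  | RCut A G D G' D' => (G `|` G', D `|` D')
  end.

Definition premises (r : rule) : seq sequent :=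
  match r with
  | RAx A => [::]
  | RBot x => [::]
  | RWL A G D => [:: (G, D)]
  | RWR A G D => [:: (G, D)]
  | RAndL x f g G D => [:: (Lab x f |` (Lab x g |` G), D)]
  | RAndR x f g G D => [:: (G, Lab x f |` D); (G, Lab x g |` D)]
  | ROrL x f g G D => [:: (Lab x f |` G, D); (Lab x g |` G, D)]
  | ROrR x f g G D => [:: (G, Lab x f |` (Lab x g |` D))]
  | RImpL x f g G D => [:: (G, Lab x f |` D); (Lab x g |` G, D)]
  | RImpR x f g G D => [:: (Lab x f |` G, Lab x g |` D)]
  | RBoxL x a y f G D => [:: (Lab y f |` G, D)]
  | RBoxR x a y f G D => [:: (Rel x a y |` G, Lab y f |` D)]
  | RSeqL x a b f G D => [:: (Lab x (Box a (Box b f)) |` G, D)]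
  | RSeqR x a b f G D => [:: (G, Lab x (Box a (Box b f)) |` D)]
  | RCupL x a b f G D => [:: (Lab x (Box a f) |` (Lab x (Box b f) |` G), D)]
  | RCupR x a b f G D =>
      [:: (G, Lab x (Box a f) |` D); (G, Lab x (Box b f) |` D)]
  | RTestL x f g G D => [:: (G, Lab x f |` D); (Lab x g |` G, D)]
  | RTestR x f g G D => [:: (Lab x f |` G, Lab x g |` D)]
  | RStarL x a f G D =>
      [:: (Lab x f |` (Lab x (Box a (Box (Star a) f)) |` G), D)]
  | RStarR x a f G D =>
      [:: (G, Lab x f |` D); (G, Lab x (Box a (Box (Star a) f)) |` D)]
  | RSubst x y G D => [:: (G, D)]
  | RCut A G D G' D' => [:: (G, A |` D); (A |` G', D')]
  end.

(* The only side condition: y does not occur in the conclusion of (BoxR). *)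
Definition side_condition (r : rule) : Prop :=
  match r with
  | RBoxR x a y f G D => fresh y (concl r).1 /\ fresh y (concl r).2
  | _ => True
  end.

(* Trace values live in succedents, so only principality of a succedent
   occurrence matters to them; rules acting on the antecedent, (Subst) and
   (Cut) have no principal item in the succedent. *)
Definition principalR (r : rule) : option item :=
  match r with
  | RAx A => Some A
  | RWR A G D => Some A
  | RAndR x f g G D => Some (Lab x (And f g))
  | ROrR x f g G D => Some (Lab x (Or f g))
  | RImpR x f g G D => Some (Lab x (Imp f g))
  | RBoxR x a y f G D => Some (Lab x (Box (Atm a) f))
  | RSeqR x a b f G D => Some (Lab x (Box (Seq a b) f))
  | RCupR x a b f G D => Some (Lab x (Box (Cup a b) f))
  | RTestR x f g G D => Some (Lab x (Box (Test f) g))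
  | RStarR x a f G D => Some (Lab x (Box (Star a) f))
  | _ => None
  end.

(* [TVal x [:: a1; ...; an] b f] stands for x : [a1]...[an][b*]f; the same
   labelled formula may be denoted by several trace values. *)
Record trace_value : Type := TVal {
  tlabel : nat;
  tspine : seq program;
  titer : program;
  tbody : formula
}.

Definition titem (t : trace_value) : item :=
  Lab (tlabel t) (foldr Box (Box (Star (titer t)) (tbody t)) (tspine t)).

Definition tpush (a : program) (t : trace_value) : trace_value :=
  TVal (tlabel t) (a :: tspine t) (titer t) (tbody t).

Definition trelabel (x : nat) (t : trace_value) : trace_value :=
  TVal x (tspine t) (titer t) (tbody t).

Definition is_principal (r : rule) (t : trace_value) : Prop :=
  principalR r = Some (titem t).

(* How a principal trace value t of the conclusion of r evolves into t' in the
   i-th premise (counted from 0).  A weakened item has no ancestor, and an item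
   principal in a propositional rule is not denoted by any trace value. *)
Definition principal_step (r : rule) (i : nat) (t t' : trace_value) : Prop :=
  match r, i with
  | RBoxR x a y _ _ _, 0 => tlabel t' = y /\ t = trelabel x (tpush (Atm a) t')
  | RTestR _ f _ _ _, 0 => t = tpush (Test f) t'
  | RSeqR _ a b _ _ _, 0 =>
      exists u, t = tpush (Seq a b) u /\ t' = tpush a (tpush b u)
  | RCupR _ a b _ _ _, 0 => exists u, t = tpush (Cup a b) u /\ t' = tpush a u
  | RCupR _ a b _ _ _, 1 => exists u, t = tpush (Cup a b) u /\ t' = tpush b u
  | RStarR _ a _ _ _, 0 => t = tpush (Star a) t'
  | RStarR _ a _ _ _, 1 => t' = tpush a t
  | _, _ => False
  end.

Definition context_step (r : rule) (t t' : trace_value) : Prop :=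
  match r with
  | RSubst x y _ _ => t = trelabel (subst_label x y (tlabel t')) t'
  | _ => t' = t
  end.

Definition trace_pair (r : rule) (i : nat) (t t' : trace_value) : Prop :=
  [/\ titem t \in (concl r).2,
      titem t' \in (nth (fset0, fset0) (premises r) i).2,
      is_principal r t -> principal_step r i t t' &
      ~ is_principal r t -> context_step r t t'].

Definition progressing_pair (r : rule) (i : nat) (t t' : trace_value) : Prop :=
  [/\ trace_pair r i t t', is_principal r t & tspine t = [::]].

(* A possibly infinite tree of rule instances, as a partial function from
   addresses; [rcons p i] is the address of the i-th child of node p. *)
Definition dtree : Type := seq nat -> option rule.

Definition derivation (T : dtree) : Prop :=
  [/\ T [::] <> None,
      forall p i, T p = None -> T (rcons p i) = None &
      forall p r, T p = Some r ->
        side_condition r /\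
        forall i, omap concl (T (rcons p i)) = onth (premises r) i].

(* An infinite path is given by the index of the premise taken at each step;
   its n-th node has address [mkseq b n]. *)
Definition infinite_path (T : dtree) (b : nat -> nat) : Prop :=
  forall n, T (mkseq b n) <> None.

Definition followed_by_progressing_trace (T : dtree) (b : nat -> nat) : Prop :=
  exists t : nat -> trace_value,
    (exists k, forall n, k <= n ->
       exists2 r, T (mkseq b n) = Some r & trace_pair r (b n) (t n) (t n.+1)) /\
    (forall m, exists n, m <= n /\
       exists2 r, T (mkseq b n) = Some r &
                  progressing_pair r (b n) (t n) (t n.+1)).

Definition G3PDL_inf_proof (T : dtree) : Prop :=
  derivation T /\
  forall b, infinite_path T b -> followed_by_progressing_trace T b.

Inductive ftree : Type :=
| FBud of sequent
| FNode of rule & seq ftree.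

Definition root_sequent (t : ftree) : sequent :=
  match t with FBud s => s | FNode r _ => concl r end.

Fixpoint subtree (t : ftree) (p : seq nat) : option ftree :=
  match p, t with
  | [::], _ => Some t
  | i :: p', FNode _ ts => obind (fun u => subtree u p') (onth ts i)
  | _ :: _, FBud _ => None
  end.

Definition finite_derivation (t : ftree) : Prop :=
  forall p r ts, subtree t p = Some (FNode r ts) ->
    side_condition r /\ map root_sequent ts = premises r.

(* c maps the address of each bud to that of its companion, which need not be
   an ancestor of the bud but must have at least one child. *)
Definition companion_assignment (t : ftree) (c : seq nat -> seq nat) : Prop :=
  forall p s, subtree t p = Some (FBud s) ->
    exists r u ts, subtree t (c p) = Some (FNode r (u :: ts)) /\ concl r = s.

Definition resolve (t : ftree) (c : seq nat -> seq nat) (p : seq nat) : seq nat :=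
  if subtree t p is Some (FBud _) then c p else p.

(* The node of t reached from its root by following the directions p, jumping
   to the companion whenever a bud is reached. *)
Definition unfold_pos (t : ftree) (c : seq nat -> seq nat) (p : seq nat) : seq nat :=
  foldl (fun q i => resolve t c (rcons q i)) (resolve t c [::]) p.

Definition unfolding (t : ftree) (c : seq nat -> seq nat) : dtree :=
  fun p => if subtree t (unfold_pos t c p) is Some (FNode r _) then Some r
           else None.

Definition G3PDL_omega_proof (t : ftree) (c : seq nat -> seq nat) : Prop :=
  [/\ finite_derivation t, companion_assignment t c &
      G3PDL_inf_proof (unfolding t c)].

Definition G3PDL_omega_derivable (s : sequent) : Prop :=
  exists t c, root_sequent t = s /\ G3PDL_omega_proof t c.

(* Main.v *)
Require Import Defs.
From Stdlib Require Import Relation_Operators.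
From mathcomp Require Import all_boot finmap boolp.

(* The canonical model of a finite closure set L consists of the consistent
   partitions C of L, those whose one-label sequent is not derivable.  The truth
   lemma requires that [a]g be derivable from C as soon as every world reached by
   a from C contains g.  Instead of the usual Segerberg-style induction on a, all
   spines s obtained by unfolding a are treated simultaneously: the disjunction
   A(s) of the characteristic formulas of the worlds from which s leads only to
   worlds containing g satisfies A(s) => A(s') for every one-step unfolding s' of
   s, up to an atomic transition or a test.  The sequents A(s) => [s]g, linked by
   the right rule for the first program of s followed by a cut on A(s'), form a
   finite graph.  On an infinite path of this graph some suffix b*::w of the
   spines is eventually permanent and exposed infinitely often, so that b* carries
   a progressing trace.  Finite graphs of rules unravel to cyclic proofs. *)

Set Implicit Arguments.
Unset Strict Implicit.
Unset Printing Implicit Defensive.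

Local Open Scope fset_scope.
Local Open Scope nat_scope.

(** * Finite proof graphs *)

Local Notation prem r i := (nth (fset0, fset0) (premises r) i).

(** The trace condition for a bare sequence of rule instances and directions, so that it also
    applies to paths of graphs. *)
Definition traced (r : nat -> rule) (b : nat -> nat) : Prop :=
  exists t : nat -> trace_value,
    (exists k, forall n, k <= n -> trace_pair (r n) (b n) (t n) (t n.+1)) /\
    (forall m, exists n, m <= n /\ progressing_pair (r n) (b n) (t n) (t n.+1)).

(** Only tails of a path matter: the shifted trace has junk values below [k], where no trace pair is
    demanded. *)
Lemma traced_shift k r b :
  traced (fun n => r (n + k)) (fun n => b (n + k)) -> traced r b.
Proof.
case=> t [[k0 tP] tQ]; exists (fun n => t (n - k)); split.
  exists (k0 + k) => n le_n; have le_kn : k <= n by exact: leq_trans (leq_addl _ _) le_n.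
  rewrite subSn //; have := tP (n - k); rewrite subnK // leq_subRL // addnC.
  exact.
move=> m; have [n [le_mn tn]] := tQ m; exists (n + k); split.
  exact: leq_trans le_mn (leq_addr _ _).
by rewrite addnK subSn ?leq_addl // addnK.
Qed.

(** The vertex [vnext v i] is meant to prove the [i]-th premise at [v]; it is arbitrary when there
    is no such premise. *)
Record cgraph : Type := CGraph {
  vertex : finType;
  vrule : vertex -> rule;
  vnext : vertex -> nat -> vertex;
  vroot : vertex
}.

Definition graph_proof (g : cgraph) : Prop :=
  [/\ forall v : vertex g, side_condition (vrule v),
      forall (v : vertex g) i, i < size (premises (vrule v)) ->
        concl (vrule (vnext v i)) = prem (vrule v) i &
      forall (v : nat -> vertex g) b,
        (forall n, b n < size (premises (vrule (v n))) /\
                   v n.+1 = vnext (v n) (b n)) ->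
        traced (fun n => vrule (v n)) b].

(** Constructions stay with graphs, which are glued by disjoint union; the passage to trees with
    buds happens once, in [omega_derivable]. *)
Definition derivable (s : sequent) : Prop :=
  exists2 g, graph_proof g & concl (vrule (vroot g)) = s.

(** * Unravelling a finite graph into a tree with buds *)

Section Unravelling.
Context (g : cgraph) (gP : graph_proof g).
Implicit Types (v : vertex g) (p : seq nat).

(* A bud is placed where a vertex is met again on its own branch, so the fuel
   #|V|.+1 used below is never exhausted. *)
Fixpoint unravel (k : nat) (seen : seq (vertex g)) v : ftree :=
  if k is k'.+1 then
    if v \in seen then FBud (concl (vrule v))
    else FNode (vrule v)
           [seq unravel k' (v :: seen) (vnext v i)
              | i <- iota 0 (size (premises (vrule v)))]
  else FBud (concl (vrule v)).

Lemma root_unravel k seen v : root_sequent (unravel k seen v) = concl (vrule v).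
Proof. by case: k => //= k; case: ifP. Qed.

Definition walk v p : vertex g := foldl (@vnext g) v p.

Lemma onth_iota m n i : onth (iota m n) i = if i < n then Some (m + i) else None.
Proof.
elim: n m i => [|n IHn] m [|i] //=; first by rewrite addn0.
by rewrite IHn ltnS addSnnS.
Qed.

Fixpoint trajectory v p : seq (vertex g) :=
  if p is i :: p' then v :: trajectory (vnext v i) p' else [::].

Lemma size_trajectory v p : size (trajectory v p) = size p.
Proof. by elim: p v => //= i p IHp v; rewrite IHp. Qed.

Lemma nth_trajectory v0 v p j :
  j < size p -> nth v0 (trajectory v p) j = walk v (take j p).
Proof. by elim: p v j => [|i p IHp] v [|j] //= lt_j; rewrite IHp. Qed.

(** Every node strictly above [p] is internal, so its vertex was unseen when met; hence [seen']
    gains exactly one new vertex per step. *)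
Lemma subtree_unravel k seen v p u : uniq seen ->
  subtree (unravel k seen v) p = Some u ->
  exists seen', [/\ u = unravel (k - size p) seen' (walk v p), uniq seen',
    size seen' = size seen + size p, size p <= k &
    forall w, (w \in seen') = (w \in seen) || (w \in trajectory v p)].
Proof.
elim: p k seen v => [|i p IHp] k seen v uniq_seen.
  rewrite /= subn0 addn0; case=> <-; exists seen; split=> // w.
  by rewrite orbF.
case: k => [|k] //=; case: ifPn => //= v_seen.
rewrite onth_map onth_iota; case: ifP => //= lt_i.
rewrite add0n => /IHp [|seen' [-> Useen' sz le_k memE]]; first by rewrite /= v_seen.
exists seen'; split=> //; first by rewrite sz /= addSnnS.
by move=> w; rewrite memE !inE -orbA orbCA.
Qed.

Let t := unravel #|vertex g|.+1 [::] (vroot g).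
Let pos p := walk (vroot g) p.
Let past p := trajectory (vroot g) p.

Lemma subtreeP p u : subtree t p = Some u ->
  u = (if pos p \in past p then FBud (concl (vrule (pos p)))
       else FNode (vrule (pos p)) (if u is FNode _ ts then ts else [::])) /\
  forall r ts, u = FNode r ts -> map root_sequent ts = premises r.
Proof.
move=> /subtree_unravel [] // seen' [-> Useen' /= sz le_p memE].
(* The [size p] vertices seen are pairwise distinct, so some fuel is left at [p]. *)
have: size p < #|vertex g|.+1.
  by rewrite ltnS -[size p]add0n -sz -(card_uniqP Useen') max_card.
rewrite -subn_gt0 /unravel; case: (_ - _) => // k _.
rewrite -/unravel memE -/(pos p) -/(past p).
case: ifP => _; split=> // r ts [<- <-].
rewrite -map_comp; apply: (@eq_from_nth _ (fset0, fset0)).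
  by rewrite size_map size_iota.
rewrite size_map size_iota => i lt_i.
rewrite (nth_map 0) ?size_iota // nth_iota //= root_unravel.
by case: gP => _ -> .
Qed.

Lemma subtree_cat (s : ftree) p q :
  subtree s (p ++ q) = obind (fun u => subtree u q) (subtree s p).
Proof.
elim: p s => [|i p IHp] [r|r ts] //=; case: (onth ts i) => //= u.
Qed.

Lemma finite_unravel : finite_derivation t.
Proof.
move=> p r ts tp; have [tpE /(_ _ _ erefl) ->] := subtreeP tp; split=> //.
by case: gP => side _ _; move: tpE; case: ifP => // _ [->].
Qed.

(** The first node of the branch that carries the same vertex as the bud. *)
Let comp p := take (index (pos p) (past p)) p.

Lemma companion_node p s : subtree t p = Some (FBud s) ->
  concl (vrule (pos p)) = s /\ pos (comp p) = pos p /\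
  exists u ts, subtree t (comp p) = Some (FNode (vrule (pos p)) (u :: ts)).
Proof.
move=> tp; have [+ _] := subtreeP tp; case: ifP => // p_past [->]; split=> //.
have lt_j : index (pos p) (past p) < size p.
  by rewrite -[ltnRHS](size_trajectory (vroot g)) index_mem.
have Epos : pos (comp p) = pos p.
  by rewrite /pos /comp -(nth_trajectory (vroot g)) // nth_index.
split=> //; move: (tp); rewrite -{1}(cat_take_drop (index (pos p) (past p)) p).
rewrite -/(comp p) subtree_cat.
case tc: (subtree t (comp p)) => [u|] //=; have [uE _] := subtreeP tc.
(* The rest of [p] is nonempty and leads on to the bud, so the companion has a child. *)
rewrite (drop_nth 0) //; move: uE; rewrite Epos.
case: u tc => [s' | r ts] tc //=; case: ifP => // _ [->].
by case: ts tc => [|u1 ts] tc; [rewrite onth0n | exists u1, ts].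
Qed.

Lemma companion_unravel : companion_assignment t comp.
Proof.
move=> p s /companion_node [? [? [u [ts tc]]]].
by exists (vrule (pos p)), u, ts.
Qed.

(** Unlike [walk], it fails at a direction that is not the index of a premise, just as the unfolding
    does. *)
Definition partial_walk p : option (vertex g) :=
  foldl (fun ov i => obind (fun v =>
      if i < size (premises (vrule v)) then Some (vnext v i) else None) ov)
    (Some (vroot g)) p.

(** A jump to a companion does not change the vertex, so following directions in the unfolding
    amounts to following them in the graph. *)
Lemma unfold_posP p :
  if partial_walk p is Some v then
    pos (unfold_pos t comp p) = v /\
    exists ts, subtree t (unfold_pos t comp p) = Some (FNode (vrule v) ts)
  else subtree t (unfold_pos t comp p) = None.
Proof.
have resolveP q u : subtree t q = Some u ->
    pos (resolve t comp q) = pos q /\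
    exists ts, subtree t (resolve t comp q) = Some (FNode (vrule (pos q)) ts).
  move=> tq; rewrite /resolve tq; case: u tq => [s|r ts] tq.
    by have [_ [-> [u [ts ->]]]] := companion_node tq; split=> //; exists (u :: ts).
  split=> //; exists ts; rewrite tq; have [+ _] := subtreeP tq.
  by case: ifP => // _ [->].
elim/last_ind: p => [|p i].
  exact: (@resolveP [::]).
rewrite /partial_walk /unfold_pos !foldl_rcons -/(partial_walk p) -/(unfold_pos t comp p).
set q := unfold_pos t comp p.
case: (partial_walk p) => [v [qE [ts tq]]|tq] /=; last first.
  by rewrite /resolve -cats1 !subtree_cat tq /= subtree_cat tq.
have /(_ _ _ erefl) Ets := (subtreeP tq).2.
have Esz : size ts = size (premises (vrule v)) by rewrite -Ets size_map.
have tqi : subtree t (rcons q i) = onth ts i.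
  by rewrite -cats1 subtree_cat tq /=; case: onth.
case: ltnP => [lt_i|le_i]; last first.
  by rewrite /resolve tqi onth_default ?Esz // tqi onth_default ?Esz.
case Ei: (onth ts i) => [u|]; last first.
  by move: lt_i; rewrite -Esz -onthTE Ei.
rewrite Ei in tqi; have [-> [ts' ->]] := resolveP _ _ tqi.
have -> : pos (rcons q i) = vnext v i by rewrite /pos /walk foldl_rcons -qE.
by split=> //; exists ts'.
Qed.

Lemma unfoldingE p : unfolding t comp p = omap (@vrule g) (partial_walk p).
Proof.
rewrite /unfolding; have := unfold_posP p.
by case: (partial_walk p) => [v [_ [ts ->]]|->].
Qed.

Lemma unfolding_proof : G3PDL_inf_proof (unfolding t comp).
Proof.
have pw_rcons p i : partial_walk (rcons p i) =
    obind (fun v => if i < size (premises (vrule v)) then Some (vnext v i) else None)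
      (partial_walk p) by rewrite /partial_walk foldl_rcons.
case: (gP) => side prems tr; split; first split.
- by rewrite unfoldingE.
- move=> p i; rewrite !unfoldingE pw_rcons; by case: partial_walk.
- move=> p r; rewrite unfoldingE.
  case Ep: (partial_walk p) => [v|] //= [<-]; split=> // i.
  rewrite unfoldingE pw_rcons Ep /=; case: ltnP => [lt_i|le_i] /=.
    by rewrite prems // onthE (nth_map (fset0, fset0)).
  by rewrite onth_default.
move=> b path_b.
have path_v n : exists v, partial_walk (mkseq b n) = Some v.
  by have := path_b n; rewrite unfoldingE; case: partial_walk => // v _; exists v.
have [v vP] := choice path_v.
have next_v n : b n < size (premises (vrule (v n))) /\ v n.+1 = vnext (v n) (b n).
  have := vP n.+1; rewrite mkseqS pw_rcons vP /=.
  by case: ifP => // _ [].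
have [x [[k xk] xinf]] := tr v b next_v; exists x; split.
  exists k => n le_kn; exists (vrule (v n)); last exact: xk.
  by rewrite unfoldingE vP.
move=> m; have [n [le_mn xn]] := xinf m; exists n; split=> //.
by exists (vrule (v n)); rewrite // unfoldingE vP.
Qed.

Lemma unravel_proof : G3PDL_omega_derivable (concl (vrule (vroot g))).
Proof.
exists t, comp; split; first exact: root_unravel.
split; [exact: finite_unravel | exact: companion_unravel | exact: unfolding_proof].
Qed.

End Unravelling.

Lemma omega_derivable s : derivable s -> G3PDL_omega_derivable s.
Proof. by case=> g gP <-; apply: unravel_proof. Qed.

(** A dummy graph for the places of [derivable_ext] where nothing has to be attached. *)
Lemma axiom_graph : exists g, graph_proof g.
Proof.
exists (CGraph (fun _ : unit => RBot 0) (fun _ _ => tt) tt).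
by split=> // v b /(_ 0) [].
Qed.

Lemma size_premises r : size (premises r) <= 2.
Proof. by case: r. Qed.

(** * Gluing a graph fragment to closed proofs of its open premises *)

Section Extension.
Context (V : finType) (rl : V -> rule) (nx : V -> nat -> option V).
Context (side : forall v, side_condition (rl v)).
Context (nxP : forall v i, i < size (premises (rl v)) ->
  if nx v i is Some w then concl (rl w) = prem (rl v) i
  else derivable (prem (rl v) i)).
Context (tr : forall (v : nat -> V) b,
  (forall n, b n < size (premises (rl (v n))) /\ nx (v n) (b n) = Some (v n.+1)) ->
  traced (fun n => rl (v n)) b).

(** A proof graph is attached at each open premise. No edge leads back from it, so an infinite path
    either ends up inside one attached graph or stays in [V], where [tr] applies. *)
Lemma derivable_ext v : derivable (concl (rl v)).
Proof.
(* A rule has at most two premises, so a boolean names one; the exits then form a finite type. *)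
have exitP (e : V * bool) : exists g, graph_proof g /\
    (e.2 < size (premises (rl e.1)) -> nx e.1 e.2 = None ->
     concl (vrule (vroot g)) = prem (rl e.1) e.2).
  case: (boolP (e.2 < size (premises (rl e.1)))) => [lt_e|_]; last first.
    by have [g gP] := axiom_graph; exists g.
  have := nxP lt_e; case: nx => [w _|[g gP <-]]; last by exists g.
  by have [g gP] := axiom_graph; exists g.
have [X XP] := choice exitP.
pose inX e (u : vertex (X e)) : {e : V * bool & vertex (X e)} := existT _ e u.
pose W := (V + {e : V * bool & vertex (X e)})%type.
pose rl' (w : W) := match w with inl v => rl v | inr u => vrule (tagged u) end.
pose nx' (w : W) i : W := match w with
  | inl v => if nx v i is Some v' then inl v'
             else inr (inX (v, i == 1) (vroot (X (v, i == 1))))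
  | inr u => inr (inX (tag u) (vnext (tagged u) i))
  end.
exists (CGraph rl' nx' (inl v)) => //; split=> /=.
- case=> [u|[e u]] /=; first exact: side.
  by have [[sd _ _] _] := XP e.
- case=> [u|[e u]] i /=; last by have [[_ pr _] _] := XP e; apply: pr.
  move=> lt_i; have := nxP lt_i; case Ei: (nx u i) => [w|] //= _.
  have iE : i = (i == 1) :> nat.
    by move: (leq_trans lt_i (size_premises _)); case: (i) => [|[|]].
  by have [_ /=] := XP (u, i == 1); rewrite -iE => ->.
- move=> w b path_w.
  have [[N [e [u wN]]]|no_exit] :=
    pselect (exists N e (u : vertex (X e)), w N = inr (inX e u)).
    apply: (@traced_shift N).
    pose us := fix us n := if n is n'.+1 then vnext (us n') (b (n' + N)) else u.
    have wE n : w (n + N) = inr (inX e (us n)).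
      elim: n => [|n IHn] //=; rewrite addSn (path_w _).2 IHn //.
    have [[_ _ /(_ us (fun n => b (n + N)))] ] := XP e.
    have -> : (fun n => rl' (w (n + N))) = (fun n => vrule (us n)).
      by apply/funext => n; rewrite wE.
    move=> tre _; apply: tre => n; have [+ _] := path_w (n + N).
    by rewrite wE.
  have wl n : exists v, w n = inl v.
    case Ew: (w n) => [u|[e u]]; first by exists u.
    by case: no_exit; exists n, e, u.
  have [vs vsP] := choice wl.
  have -> : (fun n => rl' (w n)) = (fun n => rl (vs n)).
    by apply/funext => n; rewrite vsP.
  apply: tr => n; have := path_w n; rewrite !vsP /= => -[lt_b].
  by case: nx => // v' [->].
Qed.
End Extension.

(** A one-vertex fragment all of whose premises are open; no path stays in it. *)
Lemma derivable_rule r : side_condition r ->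
  (forall s, s \in premises r -> derivable s) -> derivable (concl r).
Proof.
move=> side prems.
apply: (@derivable_ext unit (fun _ => r) (fun _ _ => None)) tt => //.
- by move=> _ i lt_i; apply: prems; rewrite mem_nth.
- by move=> v b /(_ 0) [].
Qed.

(** * Unfolding boxes along spines *)

Definition boxes (s : seq program) (f : formula) : formula := foldr Box f s.

(** The spines in the premises of the right rule for the head of [s], listed in the order of these
    premises. *)
Definition succ (s : seq program) : seq (seq program) :=
  match s with
  | [::] => [::]
  | Atm _ :: s' | Test _ :: s' => [:: s']
  | Seq a b :: s' => [:: [:: a, b & s']]
  | Cup a b :: s' => [:: a :: s'; b :: s']
  | Star a :: s' => [:: s'; [:: a, Star a & s']]
  end.

Lemma succ_cat s u : s <> [::] -> succ (s ++ u) = [seq t ++ u | t <- succ s].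
Proof. by case: s => // -[]. Qed.

(** A finite list that contains [[:: a]] and all nonempty spines obtained from it by unfolding, much
    like the partial derivatives of a regular expression. *)
Fixpoint spines (a : program) : seq (seq program) :=
  match a with
  | Atm _ | Test _ => [:: [:: a]]
  | Seq b c => [:: a] :: [seq s ++ [:: c] | s <- spines b] ++ spines c
  | Cup b c => [:: a] :: spines b ++ spines c
  | Star b => [:: a] :: [seq s ++ [:: a] | s <- spines b]
  end.

Lemma spines_self a : [:: a] \in spines a.
Proof. by case: a => *; rewrite inE eqxx. Qed.

Lemma spines_nonempty a s : s \in spines a -> s <> [::].
Proof.
elim: a s => [n|b IHb c IHc|b IHb c IHc|f|b IHb] s; rewrite !inE.
- by move=> /eqP ->.
- by rewrite mem_cat => /or3P [/eqP->|/mapP [[|? ?] _ ->]|/IHc].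
- by rewrite mem_cat => /or3P [/eqP->|/IHb|/IHc].
- by move=> /eqP ->.
- by move=> /orP [/eqP->|/mapP [[|? ?] _ ->]].
Qed.

(** When an inner spine over [b] is used up, the appended program remains: [[:: c]] for a sequence,
    the star itself for a star. *)
Lemma spines_succ a s s' :
  s \in spines a -> s' \in succ s -> s' = [::] \/ s' \in spines a.
Proof.
elim: a s s' => [n|b IHb c IHc|b IHb c IHc|f|b IHb] s s'; rewrite !inE.
- by move=> /eqP -> /=; rewrite inE => /eqP; left.
- rewrite !mem_cat => /or3P [/eqP->|/mapP [t tb ->]|sc].
  + rewrite /= inE => /eqP ->; right; apply/or3P/Or32/mapP.
    by exists [:: b] => //; apply: spines_self.
  + rewrite succ_cat; last exact: spines_nonempty tb.
    case/mapP=> t' tt' ->; right; have [->|tb'] := IHb _ _ tb tt'.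
      by rewrite /= spines_self !orbT.
    by apply/or3P/Or32/mapP; exists t'.
  + by move=> /(IHc _ _ sc) [->|->]; [left | right; rewrite !orbT].
- rewrite !mem_cat => /or3P [/eqP->|sb|sc].
  + by rewrite /= !inE => /orP [] /eqP ->; right; rewrite spines_self ?orbT.
  + by move=> /(IHb _ _ sb) [->|->]; [left | right; rewrite !orbT].
  + by move=> /(IHc _ _ sc) [->|->]; [left | right; rewrite !orbT].
- by move=> /eqP -> /=; rewrite inE => /eqP; left.
- move=> /orP [/eqP->|/mapP [t tb ->]].
  + rewrite !inE => /orP [] /eqP ->; [by left | right].
    by apply/orP/or_intror/mapP; exists [:: b] => //; apply: spines_self.
  + rewrite succ_cat; last exact: spines_nonempty tb.
    case/mapP=> t' tt' ->; right; have [->|tb'] := IHb _ _ tb tt'.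
      by rewrite /= eqxx.
    by apply/orP/or_intror/mapP; exists t'.
Qed.

(* Suffixes of a spine change only after being exposed as the whole spine, and
   every program other than a star exposed as the head is eventually consumed. *)
Lemma stable_star (sp : nat -> seq program) (act : nat -> bool) :
  (forall n, sp n <> [::]) -> (forall n, act n || act n.+1) ->
  (forall n, if act n then is_true (sp n.+1 \in succ (sp n))
             else sp n.+1 = sp n) ->
  exists N c w, (forall n, N <= n -> exists u, sp n = u ++ Star c :: w) /\
    (forall m, exists n, [/\ m <= n, act n & sp n = Star c :: w]).
Proof.
move=> nonempty actP step.
match goal with |- ?G => set good := G end.
(* Idle steps never come twice in a row, so the spine at [N] is unfolded at [N] or one step
   later. *)
have active N : exists n, [/\ N <= n, act n, sp n = sp N &
    sp n.+1 \in succ (sp N)].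
  case: (boolP (act N)) => actN.
    by exists N; split=> //; have := step N; rewrite actN.
  have := step N; rewrite (negbTE actN) => EN.
  have actN1 : act N.+1 by have := actP N; rewrite (negbTE actN).
  by exists N.+1; split=> //; have := step N.+1; rewrite actN1 EN.
(* Unless the conclusion already holds, the head [a] is consumed and leaves [w]. *)
have reach a : forall N w, sp N = a :: w ->
    good \/ exists2 n, N <= n & sp n = w.
  elim: a => [k|b IHb c IHc|b IHb c IHc|f|c IHc] N w EN.
  - have [n [le_n _ _]] := active N; rewrite EN inE => /eqP En.
    by right; exists n.+1; first exact: leqW.
  - have [n [le_n _ _]] := active N; rewrite EN inE => /eqP /IHb.
    case=> [|[m le_m /IHc]]; first by left.
    case=> [|[k le_k Ek]]; [by left | right; exists k => //].
    by apply: leq_trans le_k; apply: leq_trans le_m; apply: leqW.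
  - have [n [le_n _ _]] := active N; rewrite EN !inE => /orP [] /eqP.
      move=> /IHb [|[m le_m Em]]; [by left | right; exists m => //].
      by apply: leq_trans le_m; apply: leqW.
    move=> /IHc [|[m le_m Em]]; [by left | right; exists m => //].
    by apply: leq_trans le_m; apply: leqW.
  - have [n [le_n _ _]] := active N; rewrite EN inE => /eqP En.
    by right; exists n.+1; first exact: leqW.
  - have [|no_good] := pselect good; first by left.
    (* If [w] is never reached, the star is never given up: its suffix persists, and consuming each
       copy of [c] exposes it again. *)
    have [|no_w] := pselect (exists2 n, N <= n & sp n = w); first by right.
    have suffix n : N <= n -> exists u, sp n = u ++ Star c :: w.
      elim: n => [|n IHn]; first by rewrite leqn0 => /eqP <-; exists [::].
      rewrite leq_eqVlt => /orP [/eqP <-|]; first by exists [::].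
      rewrite ltnS => le_n; have [u Eu] := IHn le_n.
      have := step n; case: ifP => [_|_ ->]; last by exists u.
      case: u Eu => [->|h u Eu].
        rewrite /= !inE => /orP [/eqP En|/eqP ->]; last by exists [:: c].
        by case: no_w; exists n.+1 => //; apply: leqW.
      by rewrite Eu succ_cat // => /mapP [t _ ->]; exists t.
    have again m : exists2 n, m <= n & N <= n /\ sp n = Star c :: w.
      elim: m => [|m [n le_mn [le_Nn En]]]; first by exists N.
      have [k [le_k _ _]] := active n; rewrite En !inE => /orP [] /eqP Ek.
        by case: no_w; exists k.+1 => //; apply: leqW; apply: leq_trans le_k.
      have [//|[j le_j Ej]] := IHc _ _ Ek.
      have le_nj : n < j by apply: leq_trans le_j.
      exists j; first exact: leq_ltn_trans le_nj.
      by split=> //; apply: leq_trans (ltnW le_nj).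
    case: no_good; exists N, c, w; split=> // m.
    have [n le_n [_ En]] := again m; have [k [le_k actk Ek _]] := active n.
    by exists k; split=> //; [apply: leq_trans le_k | rewrite Ek].
(* Otherwise the initial spine would be consumed entirely, but no spine is empty. *)
have drain u : forall m, sp m = u -> good.
  elim: u => [|a u IHu] m Em; first by case: (nonempty m).
  by have [//|[n _ /IHu]] := reach a m u Em.
exact: drain (erefl (sp 0)).
Qed.

Lemma cat_injl (T : Type) (w s1 s2 : seq T) : s1 ++ w = s2 ++ w -> s1 = s2.
Proof.
move=> E; have := congr1 (take (size s1)) E; rewrite take_size_cat // => ->.
rewrite take_size_cat //.
by move/(congr1 size)/eqP: E; rewrite !size_cat eqn_add2r => /eqP.
Qed.

(** * The finite graph of spines and its traces *)

Section Invariant.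
Context (A : seq program -> formula) (g : formula) (a0 : program).

(* The default value is itself a successor, so every cut vertex, even one with an
   out-of-range premise index, is a correct rule instance. *)
Definition next_spine s i := nth (head [::] (succ s)) (succ s) i.

(* Two labels suffice: a transition moves from 0 to 1 or back, since the previous
   label is dropped by the cut that follows. *)
Definition next_label (s : seq program) (b : bool) :=
  if s is Atm _ :: _ then ~~ b else b.

(** The antecedent that the right rule for the head of [s] leaves in its premises. *)
Definition step_context s (b : bool) : {fset item} :=
  match s with
  | Atm n :: _ => Rel b n (~~ b) |` [fset Lab b (A s)]
  | Test f :: _ => Lab b f |` [fset Lab b (A s)]
  | _ => [fset Lab b (A s)]
  end.

Definition step_rule s (b : bool) : rule :=
  let G := [fset Lab b (A s)] in
  match s with
  | [::] => RBot 0
  | Atm n :: s' => RBoxR b n (~~ b) (boxes s' g) G fset0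
  | Seq c d :: s' => RSeqR b c d (boxes s' g) G fset0
  | Cup c d :: s' => RCupR b c d (boxes s' g) G fset0
  | Test f :: s' => RTestR b f (boxes s' g) G fset0
  | Star c :: s' => RStarR b c (boxes s' g) G fset0
  end.

(** The left premise is an instance of [step]; the right one is the conclusion of [step_rule] at the
    next spine, or of [final] if that spine is empty. *)
Definition cut_rule s (b : bool) i : rule :=
  let s' := next_spine s i in
  let y := nat_of_bool (next_label s b) in
  RCut (Lab y (A s')) (step_context s b) fset0 fset0 [fset Lab y (boxes s' g)].

Context (step : forall s s' b, s \in spines a0 -> s' \in succ s ->
  derivable (step_context s b, [fset Lab (next_label s b) (A s')])).
Context (final : forall b : bool,
  derivable ([fset Lab b (A [::])], [fset Lab b g])).

Lemma next_spine_succ s i : s <> [::] -> next_spine s i \in succ s.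
Proof.
move=> s0; rewrite /next_spine; case: (ltnP i (size (succ s))) => [|le_i].
  exact: mem_nth.
by rewrite nth_default //; case: s {le_i} s0 => // -[] *; rewrite inE eqxx.
Qed.

Lemma concl_step_rule s b : s <> [::] ->
  concl (step_rule s b) = ([fset Lab b (A s)], [fset Lab b (boxes s g)]).
Proof. by case: s => // -[] *; rewrite /= fsetU0. Qed.

Lemma prem_step_rule s b i : i < size (premises (step_rule s b)) ->
  prem (step_rule s b) i =
  (step_context s b, [fset Lab (next_label s b) (boxes (next_spine s i) g)]).
Proof.
case: s => // -[n|c d|c d|f|c] s; case: i => [|[|i]] //= _;
by rewrite fsetU0.
Qed.

Lemma concl_cut_rule s b i : concl (cut_rule s b i) =
  (step_context s b, [fset Lab (next_label s b) (boxes (next_spine s i) g)]).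
Proof. by rewrite /= fsetU0 fset0U. Qed.

(* In the first premise of the star rule an empty u would leave the spine w, which
   is too short to end in b*::w; hence only the second premise is possible there. *)
Lemma step_rule_trace u u' c w x y i :
  i < size (premises (step_rule (u ++ Star c :: w) x)) ->
  next_spine (u ++ Star c :: w) i = u' ++ Star c :: w ->
  y = next_label (u ++ Star c :: w) x ->
  principal_step (step_rule (u ++ Star c :: w) x) i
    (TVal x u c (boxes w g)) (TVal y u' c (boxes w g)).
Proof.
rewrite /next_spine => lt_i E ->; case: u lt_i E => [|h u].
  case: i => [|[|i]] //= _ E.
    move/(congr1 size)/eqP: E.
    by rewrite size_cat addnS -addSn -[X in X == _]add0n eqn_add2r.
  by rewrite -(@cat_injl _ (Star c :: w) [:: c] u').
case: h => [n|d e|d e|f|d]; case: i => [|[|i]] //= _ E.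
- by rewrite -(cat_injl E).
- rewrite -(@cat_injl _ (Star c :: w) [:: d, e & u] u') //.
  by exists (TVal x u c (boxes w g)).
- rewrite -(@cat_injl _ (Star c :: w) (d :: u) u') //.
  by exists (TVal x u c (boxes w g)).
- rewrite -(@cat_injl _ (Star c :: w) (e :: u) u') //.
  by exists (TVal x u c (boxes w g)).
- by rewrite -(cat_injl E).
- by rewrite -(cat_injl E).
- by rewrite -(@cat_injl _ (Star c :: w) [:: d, Star d & u] u').
Qed.

Notation node := (seq_sub (spines a0) * bool * option bool)%type.

(* (s, b, None) is the right rule for the head of s at label b, and
   (s, b, Some i) the cut that proves its i-th premise. *)
Let node_rule (v : node) : rule :=
  let: (s, b, c) := v in
  if c is Some i then cut_rule (val s) b (nat_of_bool i) else step_rule (val s) b.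

(** The fragment is left at the left premise of a cut and where [insub] fails; by [spines_succ] the
    next spine is then empty. *)
Let node_next (v : node) (i : nat) : option node :=
  let: (s, b, c) := v in
  if c is Some j then
    if i == 0 then None else
    omap (fun s' => (s', next_label (val s) b, None))
      (insub (next_spine (val s) (nat_of_bool j)))
  else Some (s, b, Some (i == 1)).

Let node_spine (v : node) : seq program :=
  let: (s, b, c) := v in
  if c is Some i then next_spine (val s) (nat_of_bool i) else val s.

Let node_label (v : node) : bool :=
  let: (s, b, c) := v in if c is Some i then next_label (val s) b else b.

Lemma node_succedent v :
  (concl (node_rule v)).2 = [fset Lab (node_label v) (boxes (node_spine v) g)].
Proof.
case: v => -[s b] [i|]; first by rewrite /node_rule concl_cut_rule.
by rewrite /node_rule concl_step_rule // => /(spines_nonempty (ssvalP s)).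
Qed.

Lemma nat_of_eq1 r i : i < size (premises r) -> nat_of_bool (i == 1) = i.
Proof. by move/leq_trans/(_ (size_premises _)); case: i => [|[|]]. Qed.

Lemma node_nextP v i : i < size (premises (node_rule v)) ->
  if node_next v i is Some w then concl (node_rule w) = prem (node_rule v) i
  else derivable (prem (node_rule v) i).
Proof.
case: v => -[s b] [j|] lt_i; have sa : val s \in spines a0 := ssvalP s;
have s0 := spines_nonempty sa.
  have s's : next_spine (val s) j \in succ (val s) by apply: next_spine_succ.
  rewrite /node_rule /node_next; case: i lt_i => [|[|i]] //= _.
    by rewrite fsetU0; apply: step.
  rewrite fsetU0; case: insubP => /= [t _ Et|].
    by rewrite concl_step_rule Et //; rewrite -Et => /(spines_nonempty (ssvalP t)).
  by have [->|->] := spines_succ sa s's.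
rewrite prem_step_rule //; apply: etrans (concl_cut_rule _ _ _) _.
by rewrite (nat_of_eq1 lt_i).
Qed.

(** Spines unfold at right rules and rest at cuts, so [stable_star] yields a lasting suffix
    [Star c :: w]. What precedes it is the spine of the trace value, and it is empty whenever the
    star is exposed at a right rule. *)
Lemma node_traced (v : nat -> node) b :
  (forall n, b n < size (premises (node_rule (v n))) /\
             node_next (v n) (b n) = Some (v n.+1)) ->
  traced (fun n => node_rule (v n)) b.
Proof.
move=> path_v.
pose sp n := node_spine (v n); pose act n := (v n).2 == None.
have stepP n : if act n then next_spine (sp n) (b n) = sp n.+1 /\
       node_label (v n.+1) = next_label (sp n) (node_label (v n)) /\
       node_rule (v n) = step_rule (sp n) (node_label (v n))
    else [/\ sp n.+1 = sp n, node_label (v n.+1) = node_label (v n),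
             act n.+1 & exists s b i, node_rule (v n) = cut_rule s b i].
  have [lt_b Ev1] := path_v n; rewrite /act /sp; move: lt_b Ev1.
  case: (v n) => -[s c] [j|] lt_b /=.
    case: (_ == 0) => //; case: insubP => //= t _ Et [<-] /=.
    by split=> //; exists (val s), c, j.
  by case=> <- /=; rewrite (nat_of_eq1 lt_b).
have sp_act n : act n -> sp n <> [::].
  by rewrite /act /sp; case: (v n) => -[s c] [] //= _ /(spines_nonempty (ssvalP s)).
have sp0 n : sp n <> [::].
  by have := stepP n; case: ifP => [/sp_act //|_ [<- _ /sp_act]].
have succP n : act n -> sp n.+1 \in succ (sp n).
  by move=> actn; have := stepP n; rewrite actn => -[<- _]; apply: next_spine_succ.
have [N [c [w [suffix often]]]] : exists N c w,
    (forall n, N <= n -> exists u, sp n = u ++ Star c :: w) /\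
    (forall m, exists n, [/\ m <= n, act n & sp n = Star c :: w]).
  apply: stable_star => // n; last first.
    by have := stepP n; case: ifP => [/succP //|_ []].
  by have := stepP n; case: ifP => // _ [].
have /choice [u uE] n : exists u, N <= n -> sp n = u ++ Star c :: w.
  case: (leqP N n) => [/suffix [u Eu]|_]; first by exists u.
  by exists [::].
pose t n := TVal (node_label (v n)) (u n) c (boxes w g).
have titemE n : N <= n -> titem (t n) = Lab (node_label (v n)) (boxes (sp n) g).
  by move=> /uE ->; rewrite /titem /boxes foldr_cat.
have pair n : N <= n -> trace_pair (node_rule (v n)) (b n) (t n) (t n.+1).
  move=> le_n; have le_n1 := leqW le_n; have [lt_b Ev1] := path_v n.
  have premE : (prem (node_rule (v n)) (b n)).2 = [fset titem (t n.+1)].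
    by have := node_nextP lt_b; rewrite Ev1 titemE // => <-; apply: node_succedent.
  (* A cut has no principal item, so it keeps the trace value; at a right rule [step_rule_trace]
     applies. *)
  have := stepP n; case: ifP => actn; last first.
    case=> Esp El _ [s [d [i Er]]]; split.
    - by rewrite node_succedent titemE // inE.
    - by rewrite premE inE.
    - by rewrite /is_principal Er.
    - move=> _; rewrite Er /= /t El; congr TVal.
      by apply: (@cat_injl _ (Star c :: w)); rewrite -!uE.
  case=> Enext [El Er]; split.
  - by rewrite node_succedent titemE // inE.
  - by rewrite premE inE.
  - move=> _; move: lt_b Enext El; rewrite Er !(uE _ le_n) (uE _ le_n1).
    exact: step_rule_trace.
  - case; rewrite /is_principal titemE // Er.
    by case: (sp n) (sp0 n) => // -[].
exists t; split; first by exists N.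
move=> m; have [n [le_n actn En]] := often (maxn N m).
move: le_n; rewrite geq_max => /andP [le_Nn le_mn]; exists n; split=> //.
have un0 : u n = [::] by apply: (@cat_injl _ (Star c :: w)); rewrite -uE.
split; [exact: pair | | exact: un0].
have := stepP n; rewrite actn => -[_ [_ Er]].
by rewrite /is_principal titemE // Er En.
Qed.

Lemma invariant_box (b : bool) :
  derivable ([fset Lab b (A [:: a0])], [fset Lab b (Box a0 g)]).
Proof.
pose v : node := (SeqSub (spines_self a0), b, None).
rewrite -[X in derivable X](concl_step_rule b (s := [:: a0])) //.
apply: (@derivable_ext _ node_rule node_next) v.
(* Only an atomic head has a side condition: the conclusion mentions the label [c] alone, so [~~ c]
   is fresh. *)
- case=> -[s c] [i|] //=; have := spines_nonempty (ssvalP s).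
  case: s => /= -[|[n|||f|] s] //= _ _.
  by split=> I; rewrite ?fsetU0 inE => /eqP ->; case: c.
- exact: node_nextP.
- exact: node_traced.
Qed.
End Invariant.

(** * Derived rules on sequents given by predicates *)

Lemma mem_foldr_fset1U (l : seq item) G A :
  (A \in foldr (fun B H => B |` H) G l) = (A \in l) || (A \in G).
Proof. by elim: l => //= B l IHl; rewrite !inE IHl orbA. Qed.

Lemma derivable_weaken G D G' D' :
  derivable (G, D) -> G `<=` G' -> D `<=` D' -> derivable (G', D').
Proof.
move=> GD /fsubsetP GG' /fsubsetP DD'.
(* As [G] is included in [G'], inserting all elements of [G'] into [G] gives [G'], one weakening per
   element. *)
have -> : G' = foldr (fun B H => B |` H) G (enum_fset G').
  apply/fsetP => A; rewrite mem_foldr_fset1U; apply/idP/orP; first by left.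
  by case=> // /GG'.
have -> : D' = foldr (fun B H => B |` H) D (enum_fset D').
  apply/fsetP => A; rewrite mem_foldr_fset1U; apply/idP/orP; first by left.
  by case=> // /DD'.
elim: (enum_fset G') => [|A l IHl] /=; last first.
  by apply: (@derivable_rule (RWL A _ _)) => //= s; rewrite inE => /eqP ->.
elim: (enum_fset D') => [|A l IHl] //=.
by apply: (@derivable_rule (RWR A _ _)) => //= s; rewrite inE => /eqP ->.
Qed.

(* P and Q may be infinite, so that weakening is inclusion and contexts need no
   finite-set bookkeeping. *)
Definition der (P Q : item -> Prop) : Prop :=
  exists G D : {fset item}, [/\ derivable (G, D),
    forall A, A \in G -> P A & forall A, A \in D -> Q A].

Lemma der_derivable (G D : {fset item}) :
  der (fun A => A \in G) (fun A => A \in D) -> derivable (G, D).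
Proof.
by case=> G' [D' [GD GG DD]]; apply: derivable_weaken GD _ _; apply/fsubsetP.
Qed.

Lemma derivable_der (G D : {fset item}) (P Q : item -> Prop) : derivable (G, D) ->
  (forall A, A \in G -> P A) -> (forall A, A \in D -> Q A) -> der P Q.
Proof. by move=> GD GP DQ; exists G, D. Qed.

Lemma der_weaken (P Q P' Q' : item -> Prop) : der P Q ->
  (forall A, P A -> P' A) -> (forall A, Q A -> Q' A) -> der P' Q'.
Proof.
by case=> G [D [GD GP DQ]] PP QQ; exists G, D; split=> // A; [move/GP/PP | move/DQ/QQ].
Qed.

Lemma der_ax A (P Q : item -> Prop) : P A -> Q A -> der P Q.
Proof.
move=> PA QA; exists [fset A], [fset A].
split; try by move=> B; rewrite inE => /eqP ->.
exact: (@derivable_rule (RAx A)).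
Qed.

Lemma der_bot x (P Q : item -> Prop) : P (Lab x Bot) -> der P Q.
Proof.
move=> PA; exists [fset Lab x Bot], fset0; split=> // [|B]; last by rewrite inE => /eqP ->.
exact: (@derivable_rule (RBot x)).
Qed.

Definition plus (l : seq item) (P : item -> Prop) : item -> Prop :=
  fun A => A \in l \/ P A.

Definition fset_of (l : seq item) (G : {fset item}) := [fset A in l] `|` G.

Lemma in_fset_of l G A : (A \in fset_of l G) = (A \in l) || (A \in G).
Proof. by rewrite !inE. Qed.

(** Each premise comes with finite contexts of its own; the rule is applied with contexts large
    enough for all of them. *)
Lemma der_rule (r : {fset item} -> {fset item} -> rule) (cl cr : seq item)
    (prs : seq (seq item * seq item)) (P Q : item -> Prop) :
  (forall G D, [/\ side_condition (r G D),
     concl (r G D) = (fset_of cl G, fset_of cr D) &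
     premises (r G D) = [seq (fset_of p.1 G, fset_of p.2 D) | p <- prs]]) ->
  (forall A, A \in cl -> P A) -> (forall A, A \in cr -> Q A) ->
  (forall p, p \in prs -> der (plus p.1 P) (plus p.2 Q)) -> der P Q.
Proof.
move=> rP clP crQ prsP.
have [G [D [GP DQ GD]]] : exists G D : {fset item},
    [/\ forall A, A \in G -> P A, forall A, A \in D -> Q A &
     forall p, p \in prs -> derivable (fset_of p.1 G, fset_of p.2 D)].
  elim: (prs) prsP => [|p l IHl] lP; first by exists fset0, fset0.
  have [|G [D [GP DQ GD]]] := IHl; first by move=> q lq; apply: lP; rewrite inE lq orbT.
  have [|G' [D' [GD' GP' DQ']]] := lP p; first by rewrite inE eqxx.
  (* Items displayed in [p] need not satisfy [P] or [Q], so they are kept out of the common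
     contexts. *)
  exists (G `|` [fset A in G' | A \notin p.1]), (D `|` [fset A in D' | A \notin p.2]).
  split=> [A|A|q].
  - rewrite !inE => /orP [/GP //|/andP [/GP' []]]; by [move=> -> | ].
  - rewrite !inE => /orP [/DQ //|/andP [/DQ' []]]; by [move=> -> | ].
  - rewrite inE => /orP [/eqP ->|lq].
      apply: derivable_weaken GD' _ _; apply/fsubsetP => A; rewrite in_fset_of !inE => ->;
      by rewrite orbCA orbN orbT.
    apply: derivable_weaken (GD q lq) _ _; apply/fsubsetP => A;
    by rewrite !in_fset_of !inE => /orP [] ->; rewrite ?orbT.
have [sd ccl prE] := rP G D.
exists (fset_of cl G), (fset_of cr D); split.
- by rewrite -ccl; apply: derivable_rule => // s; rewrite prE => /mapP [p /GD ? ->].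
- by move=> A; rewrite in_fset_of => /orP [/clP|/GP].
- by move=> A; rewrite in_fset_of => /orP [/crQ|/DQ].
Qed.

Lemma fset_of0 G : fset_of [::] G = G.
Proof. by apply/fsetP => A; rewrite in_fset_of. Qed.
Lemma fset_of1 A G : fset_of [:: A] G = A |` G.
Proof. by apply/fsetP => B; rewrite in_fset_of !inE. Qed.
Lemma fset_of2 A B G : fset_of [:: A; B] G = A |` (B |` G).
Proof. by apply/fsetP => C; rewrite in_fset_of !inE orbA. Qed.

Definition fset_ofE := (fset_of0, fset_of1, fset_of2).

(** * Cut, propositional rules and left box rules for predicates *)

Section Rules.
Context (P Q : item -> Prop).

Ltac by_rule r cl cr prs :=
  apply: (@der_rule r cl cr prs);
  [ by move=> *; rewrite /= ?fset_ofE ?fsetUid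
  | by move=> ?; rewrite !inE => // /eqP ->
  | by move=> ?; rewrite !inE => // /eqP ->
  | by move=> ?; rewrite !inE; (move=> /orP [] /eqP -> || move=> /eqP ->) => /=;
       match goal with d : der _ _ |- _ => by apply: (der_weaken d) => // ?; right end ].

Lemma der_cut A : der P (plus [:: A] Q) -> der (plus [:: A] P) Q -> der P Q.
Proof.
move=> d1 d2; by_rule (fun G D => RCut A G D G D) (Nil item) (Nil item)
  [:: ([::], [:: A]); ([:: A], [::])].
Qed.

Lemma der_andL x f g : P (Lab x (And f g)) ->
  der (plus [:: Lab x f; Lab x g] P) Q -> der P Q.
Proof.
move=> PA d1; by_rule (RAndL x f g) [:: Lab x (And f g)] (Nil item)
  [:: ([:: Lab x f; Lab x g], Nil item)].
Qed.

Lemma der_andR x f g : Q (Lab x (And f g)) ->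
  der P (plus [:: Lab x f] Q) -> der P (plus [:: Lab x g] Q) -> der P Q.
Proof.
move=> QA d1 d2; by_rule (RAndR x f g) (Nil item) [:: Lab x (And f g)]
  [:: (Nil item, [:: Lab x f]); (Nil item, [:: Lab x g])].
Qed.

Lemma der_orL x f g : P (Lab x (Or f g)) ->
  der (plus [:: Lab x f] P) Q -> der (plus [:: Lab x g] P) Q -> der P Q.
Proof.
move=> PA d1 d2; by_rule (ROrL x f g) [:: Lab x (Or f g)] (Nil item)
  [:: ([:: Lab x f], Nil item); ([:: Lab x g], Nil item)].
Qed.

Lemma der_orR x f g : Q (Lab x (Or f g)) ->
  der P (plus [:: Lab x f; Lab x g] Q) -> der P Q.
Proof.
move=> QA d1; by_rule (ROrR x f g) (Nil item) [:: Lab x (Or f g)]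
  [:: (Nil item, [:: Lab x f; Lab x g])].
Qed.

Lemma der_impL x f g : P (Lab x (Imp f g)) ->
  der P (plus [:: Lab x f] Q) -> der (plus [:: Lab x g] P) Q -> der P Q.
Proof.
move=> PA d1 d2; by_rule (RImpL x f g) [:: Lab x (Imp f g)] (Nil item)
  [:: (Nil item, [:: Lab x f]); ([:: Lab x g], Nil item)].
Qed.

Lemma der_impR x f g : Q (Lab x (Imp f g)) ->
  der (plus [:: Lab x f] P) (plus [:: Lab x g] Q) -> der P Q.
Proof.
move=> QA d1; by_rule (RImpR x f g) (Nil item) [:: Lab x (Imp f g)]
  [:: ([:: Lab x f], [:: Lab x g])].
Qed.

Lemma der_boxL x a y f : P (Lab x (Box (Atm a) f)) -> P (Rel x a y) ->
  der (plus [:: Lab y f] P) Q -> der P Q.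
Proof.
move=> PA PR d1.
apply: (@der_rule (RBoxL x a y f) [:: Lab x (Box (Atm a) f); Rel x a y] [::]
  [:: ([:: Lab y f], [::])]) => //=.
- by move=> G D; rewrite !fset_ofE.
- by move=> A; rewrite !inE => /orP [] /eqP ->.
- by move=> p; rewrite inE => /eqP ->; apply: der_weaken d1 _ _ => //; right.
Qed.

Lemma der_seqL x a b f : P (Lab x (Box (Seq a b) f)) ->
  der (plus [:: Lab x (Box a (Box b f))] P) Q -> der P Q.
Proof.
move=> PA d1; by_rule (RSeqL x a b f) [:: Lab x (Box (Seq a b) f)] (Nil item)
  [:: ([:: Lab x (Box a (Box b f))], Nil item)].
Qed.

Lemma der_cupL x a b f : P (Lab x (Box (Cup a b) f)) ->
  der (plus [:: Lab x (Box a f); Lab x (Box b f)] P) Q -> der P Q.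
Proof.
move=> PA d1; by_rule (RCupL x a b f) [:: Lab x (Box (Cup a b) f)] (Nil item)
  [:: ([:: Lab x (Box a f); Lab x (Box b f)], Nil item)].
Qed.

Lemma der_testL x f g : P (Lab x (Box (Test f) g)) ->
  der P (plus [:: Lab x f] Q) -> der (plus [:: Lab x g] P) Q -> der P Q.
Proof.
move=> PA d1 d2; by_rule (RTestL x f g) [:: Lab x (Box (Test f) g)] (Nil item)
  [:: (Nil item, [:: Lab x f]); ([:: Lab x g], Nil item)].
Qed.

Lemma der_starL x a f : P (Lab x (Box (Star a) f)) ->
  der (plus [:: Lab x f; Lab x (Box a (Box (Star a) f))] P) Q -> der P Q.
Proof.
move=> PA d1; by_rule (RStarL x a f) [:: Lab x (Box (Star a) f)] (Nil item)
  [:: ([:: Lab x f; Lab x (Box a (Box (Star a) f))], Nil item)].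
Qed.

End Rules.

(** * Canonical model *)

Scheme formula_mind := Induction for formula Sort Prop
  with program_mind := Induction for program Sort Prop.
Combined Scheme formula_program_ind from formula_mind, program_mind.

Definition children (f : formula) : seq formula :=
  match f with
  | And f g | Or f g | Imp f g => [:: f; g]
  | Box a f => f :: match a with
                    | Atm _ => [::]
                    | Seq b c => [:: Box b (Box c f)]
                    | Cup b c => [:: Box b f; Box c f]
                    | Test g => [:: g]
                    | Star b => [:: Box b (Box a f)]
                    end
  | _ => [::]
  end.

(** The Fischer-Ladner closure. [box_closure a g] leaves out the closure of [g], which keeps the
    recursion structural although [g] grows under sequences and stars. *)
Fixpoint closure (f : formula) : seq formula :=
  match f with
  | Bot | Prp _ => [:: f]
  | And g h | Or g h | Imp g h => f :: closure g ++ closure h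
  | Box a g => box_closure a g ++ closure g
  end
with box_closure (a : program) (g : formula) : seq formula :=
  match a with
  | Atm _ => [:: Box a g]
  | Seq b c => Box a g :: box_closure b (Box c g) ++ box_closure c g
  | Cup b c => Box a g :: box_closure b g ++ box_closure c g
  | Test f => Box a g :: closure f
  | Star b => Box a g :: box_closure b (Box a g)
  end.

Lemma box_closure_self a g : Box a g \in box_closure a g.
Proof. by case: a => *; rewrite inE eqxx. Qed.

Lemma closure_self f : f \in closure f.
Proof. by case: f => *; rewrite ?mem_cat ?inE ?eqxx ?box_closure_self. Qed.

(** The program clause adds [g], the one child that [box_closure a g] may miss. *)
Lemma closure_closed :
  (forall f h, h \in closure f -> {subset children h <= closure f}) /\
  (forall a g h, h \in box_closure a g ->
     {subset children h <= g :: box_closure a g}).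
Proof.
have binary f g k0 : children k0 = [:: f; g] ->
    (forall h, h \in closure f -> {subset children h <= closure f}) ->
    (forall h, h \in closure g -> {subset children h <= closure g}) ->
    forall h, h \in k0 :: closure f ++ closure g ->
      {subset children h <= k0 :: closure f ++ closure g}.
  move=> k0E IHf IHg h; rewrite inE mem_cat => /or3P [/eqP ->|/IHf sub|/IHg sub] k.
  - by rewrite k0E !inE mem_cat => /orP [] /eqP ->; rewrite closure_self !orbT.
  - by move/sub; rewrite inE mem_cat => ->; rewrite !orbT.
  - by move/sub; rewrite inE mem_cat => ->; rewrite !orbT.
apply: formula_program_ind => /=.
- by move=> h; rewrite inE => /eqP ->.
- by move=> n h; rewrite inE => /eqP ->.
- by move=> f IHf g IHg; apply: binary.
- by move=> f IHf g IHg; apply: binary.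
- by move=> f IHf g IHg; apply: binary.
- move=> a IHa g IHg h; rewrite mem_cat => /orP [/IHa sub|/IHg sub] k.
  + move/sub; rewrite inE mem_cat => /orP [/eqP ->|->] //.
    by rewrite closure_self orbT.
  + by move/sub; rewrite mem_cat => ->; rewrite orbT.
- move=> n g h; rewrite inE => /eqP -> k; rewrite !inE => ->; by [].
- move=> a IHa b IHb g h; rewrite inE mem_cat => /or3P [/eqP ->|/IHa sub|/IHb sub] k.
  + rewrite !inE mem_cat => /orP [] /eqP ->; by rewrite ?eqxx ?box_closure_self ?orbT.
  + move/sub; rewrite !inE mem_cat => /orP [/eqP ->|->]; by rewrite ?box_closure_self ?orbT.
  + move/sub; rewrite !inE mem_cat => /orP [/eqP ->|->]; by rewrite ?eqxx ?orbT.
- move=> a IHa b IHb g h; rewrite inE mem_cat => /or3P [/eqP ->|/IHa sub|/IHb sub] k.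
  + rewrite !inE mem_cat => /or3P [] /eqP ->; by rewrite ?eqxx ?box_closure_self ?orbT.
  + move/sub; rewrite !inE mem_cat => /orP [/eqP ->|->]; by rewrite ?eqxx ?orbT.
  + move/sub; rewrite !inE mem_cat => /orP [/eqP ->|->]; by rewrite ?eqxx ?orbT.
- move=> f IHf g h; rewrite inE => /orP [/eqP ->|/IHf sub] k.
  + rewrite !inE => /orP [] /eqP ->; by rewrite ?eqxx ?closure_self ?orbT.
  + by move/sub; rewrite !inE => ->; rewrite !orbT.
- move=> a IHa g h; rewrite inE => /orP [/eqP ->|/IHa sub] k.
  + rewrite !inE => /orP [] /eqP ->; by rewrite ?eqxx ?box_closure_self ?orbT.
  + move/sub; rewrite !inE => /orP [/eqP ->|->]; by rewrite ?eqxx ?orbT.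
Qed.

(** Only outermost tests, those evaluated directly in a run of the program. *)
Fixpoint tests (a : program) : seq formula :=
  match a with
  | Atm _ => [::]
  | Seq b c | Cup b c => tests b ++ tests c
  | Test f => [:: f]
  | Star b => tests b
  end.

Lemma spines_tests a s h :
  s \in spines a -> h \in s -> {subset tests h <= tests a}.
Proof.
elim: a s h => [n|b IHb c IHc|b IHb c IHc|f|b IHb] s h; rewrite !inE.
- by move=> /eqP ->; rewrite inE => /eqP ->.
- rewrite mem_cat => /or3P [/eqP->|/mapP [t tb ->]|sc].
  + by rewrite inE => /eqP ->.
  + rewrite mem_cat inE => /orP [/(IHb _ _ tb) sub f /sub|/eqP -> f /=];
    by rewrite mem_cat => ->; rewrite ?orbT.
  + by move=> /(IHc _ _ sc) sub f /sub /=; rewrite mem_cat => ->; rewrite orbT.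
- rewrite mem_cat => /or3P [/eqP->|sb|sc].
  + by rewrite inE => /eqP ->.
  + by move=> /(IHb _ _ sb) sub f /sub /=; rewrite mem_cat => ->.
  + by move=> /(IHc _ _ sc) sub f /sub /=; rewrite mem_cat => ->; rewrite orbT.
- by move=> /eqP ->; rewrite inE => /eqP ->.
- move=> /orP [/eqP->|/mapP [t tb ->]].
  + by rewrite inE => /eqP ->.
  + by rewrite mem_cat inE => /orP [/(IHb _ _ tb)|/eqP -> ].
Qed.

(** * Partitions, worlds and characteristic formulas *)

Section Canonical.
Context (L : {fset formula}).
Context (Lclosed : forall h, h \in L -> {subset children h <= L}).
Implicit Types (C : {fset formula}) (P Q : item -> Prop).

Lemma tests_closed a g : Box a g \in L -> {subset tests a <= L}.
Proof.
elim: a g => [n|b IHb c IHc|b IHb c IHc|f|b IHb] g /Lclosed sub h //=.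
- have bL : Box b (Box c g) \in L by apply: sub; rewrite !inE eqxx orbT.
  have cL : Box c g \in L by apply: (Lclosed bL); rewrite inE eqxx.
  by rewrite mem_cat => /orP [/(IHb _ bL)|/(IHc _ cL)].
- have bL : Box b g \in L by apply: sub; rewrite !inE eqxx orbT.
  have cL : Box c g \in L by apply: sub; rewrite !inE eqxx !orbT.
  by rewrite mem_cat => /orP [/(IHb _ bL)|/(IHc _ cL)].
- by rewrite inE => /eqP ->; apply: sub; rewrite !inE eqxx orbT.
- by apply: (IHb (Box (Star b) g)); apply: sub; rewrite !inE eqxx orbT.
Qed.

Definition pos_part x C : item -> Prop := fun A => exists2 f, f \in C & A = Lab x f.
Definition neg_part x C : item -> Prop := pos_part x (L `\` C).

Definition join (P Q : item -> Prop) : item -> Prop := fun A => P A \/ Q A.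

Definition consistent C : Prop :=
  C `<=` L /\ ~ der (pos_part 0 C) (neg_part 0 C).

(** Consistency is stated at label 0; (Subst) carries the derivation to [x]. *)
Lemma inconsistent_der x C : C `<=` L -> ~ consistent C ->
  der (pos_part x C) (neg_part x C).
Proof.
move=> CL nC; have d0 : der (pos_part 0 C) (neg_part 0 C).
  by apply: contrapT => nd; apply: nC; split.
have {}d0 : derivable ([fset Lab 0 f | f in C], [fset Lab 0 f | f in L `\` C]).
  apply: der_derivable; apply: der_weaken d0 _ _ => A [f fC ->];
  by apply/imfsetP; exists f.
apply: (@derivable_der (subst_set 0 x [fset Lab 0 f | f in C])
    (subst_set 0 x [fset Lab 0 f | f in L `\` C])).
- by apply: (@derivable_rule (RSubst 0 x _ _)) => // s; rewrite inE => /eqP ->.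
- by move=> A /imfsetP [B /imfsetP [f fC ->] ->]; exists f.
- by move=> A /imfsetP [B /imfsetP [f fC ->] ->]; exists f.
Qed.

(** Cutting on every formula of [L] at [x] leaves one branch per partition. *)
Lemma der_cases x P Q :
  (forall C, C `<=` L -> der (join (pos_part x C) P) (join (neg_part x C) Q)) ->
  der P Q.
Proof.
have cases (l : seq formula) : forall P Q,
    (forall c : pred formula,
      der (fun A => (exists f, [/\ f \in l, c f & A = Lab x f]) \/ P A)
          (fun A => (exists f, [/\ f \in l, ~~ c f & A = Lab x f]) \/ Q A)) ->
    der P Q.
  elim: l => [|f l IHl] {}P {}Q H.
    by apply: der_weaken (H xpred0) _ _ => A [[g []]|].
  (* The side on which the cut puts [f] overrides [c], since [f] may occur again in [l]. *)
  apply: (@der_cut _ _ (Lab x f)); apply: IHl => c.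
    apply: der_weaken (H (fun g => (g != f) && c g)) _ _ => A.
      case=> [[g []]|]; last by right.
      rewrite inE => /orP [/eqP ->|gl] /andP [gf cg] ->; first by rewrite eqxx in gf.
      by left; exists g.
    case=> [[g []]|]; last by right; right.
    rewrite inE negb_and negbK; case: eqP => /= [-> _ _ ->|_ gl ncg ->].
      by right; left; rewrite inE.
    by left; exists g.
  apply: der_weaken (H (fun g => (g == f) || c g)) _ _ => A.
    case=> [[g []]|]; last by right; right.
    rewrite inE; case: eqP => /= [-> _ _ ->|_ gl cg ->].
      by right; left; rewrite inE.
    by left; exists g.
  case=> [[g []]|]; last by right.
  rewrite inE negb_or => /orP [/eqP ->|gl] /andP [gf cg] ->; first by rewrite eqxx in gf.
  by left; exists g.
move=> H; apply: (cases (enum_fset L)) => c.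
apply: der_weaken (H [fset f in L | c f] _) _ _.
- by apply/fsubsetP => f; rewrite !inE => /andP [].
- move=> A [[f]|]; last by right.
  by rewrite !inE => /andP [fL cf] ->; left; exists f.
- move=> A [[f]|]; last by right.
  rewrite !inE => /andP [+ fL] ->; rewrite fL => ncf.
  by left; exists f.
Qed.

Definition world : Type := {C : {fset formula} | consistent C}.
Implicit Types w u v : world.
Coercion world_set w : {fset formula} := projT1 w.

Lemma world_sub w : {subset world_set w <= L}.
Proof. case: w => C cC; exact: (fsubsetP cC.1). Qed.

Definition canonical : model :=
  @Model world (fun p w => Prp p \in world_set w)
    (fun a w v => forall f, Box (Atm a) f \in world_set w -> f \in world_set v).

Lemma world_der w : ~ der (pos_part 0 w) (neg_part 0 w).
Proof. by case: w => C []. Qed.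

(** Otherwise weakening would turn the given derivation into one of the sequent of [w]. *)
Lemma world_entails w (fs gs : seq formula) :
  der (fun A => A \in map (Lab 0) fs) (fun A => A \in map (Lab 0) gs) ->
  {subset fs <= world_set w} -> {subset gs <= L} ->
  exists2 g, g \in gs & g \in world_set w.
Proof.
move=> d fw gL; apply: contrapT => no_g; apply: (@world_der w).
apply: der_weaken d _ _ => A /mapP [f fl ->]; exists f => //; first exact: fw.
rewrite inE gL // andbT; apply/negP => fw'.
by apply: no_g; exists f.
Qed.

Definition truth (f : formula) : Prop :=
  forall w, @sat canonical f w <-> f \in world_set w.

Definition literal C (f : formula) : formula := if f \in C then f else Imp f Bot.

Definition conjs (l : seq formula) : formula := foldr And (Imp Bot Bot) l.
Definition disjs (l : seq formula) : formula := foldr Or Bot l.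

Definition char_formula C : formula := conjs (map (literal C) (enum_fset L)).

(** Decomposing the conjunction restores the partition: a negated literal moves its formula to the
    succedent by the left implication rule. *)
Lemma der_charL x C P Q : C `<=` L -> P (Lab x (char_formula C)) ->
  der (join (pos_part x C) P) (join (neg_part x C) Q) -> der P Q.
Proof.
have conjL (l : seq formula) : forall P,
    P (Lab x (conjs (map (literal C) l))) ->
    der (join (fun A => exists f, [/\ f \in l, f \in C & A = Lab x f]) P)
        (join (fun A => exists f, [/\ f \in l, f \notin C & A = Lab x f]) Q) ->
    der P Q.
  elim: l => [|f l IHl] {}P PA d; first by apply: der_weaken d _ _ => A [[f []]|].
  apply: (der_andL PA); apply: IHl; first by left; rewrite !inE eqxx orbT.
  case: (boolP (f \in C)) => fC.
    apply: der_weaken d _ _ => A.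
    - case=> [[h []]|]; last by right; right.
      rewrite inE => /orP [/eqP -> _ ->|hl hC ->]; last by left; exists h.
      by right; left; rewrite /literal fC inE eqxx.
    - case=> [[h []]|]; last by right.
      rewrite inE => /orP [/eqP ->|hl hC ->]; last by left; exists h.
      by rewrite fC.
  apply: (@der_impL _ _ x f Bot).
  - by right; left; rewrite /literal (negbTE fC) inE eqxx.
  - apply: der_weaken d _ _ => A.
    + case=> [[h []]|]; last by right; right.
      rewrite inE => /orP [/eqP ->|hl hC ->]; last by left; exists h.
      by rewrite (negbTE fC).
    + case=> [[h []]|]; last by right; right.
      rewrite inE => /orP [/eqP -> _ ->|hl hC ->]; last by right; left; exists h.
      by left; rewrite inE.
  - by apply: (@der_bot x); left; rewrite inE.
move=> /fsubsetP CL PA d; apply: (conjL _ _ PA); apply: der_weaken d _ _ => A.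
  case=> [[f fC ->]|]; last by right.
  by left; exists f; split=> //; apply: CL.
case=> [[f + ->]|]; last by right.
by rewrite inE => /andP [fC fL]; left; exists f.
Qed.

Lemma der_charR x C P Q : Q (Lab x (char_formula C)) ->
  (forall A, pos_part x C A -> P A) -> (forall A, neg_part x C A -> Q A) ->
  der P Q.
Proof.
move=> + CP CQ; have: {subset enum_fset L <= L} by [].
rewrite /char_formula; elim: (enum_fset L) Q CQ => [|f l IHl] {}Q CQ lL QA.
  by apply: (der_impR QA); apply: (@der_bot x); left; rewrite inE.
apply: (der_andR QA); last first.
  apply: IHl => [A /CQ ?|h hl|]; [by right | by apply: lL; rewrite inE hl orbT |].
  by left; rewrite inE.
case: (boolP (f \in C)) => fC.
  apply: (@der_ax (Lab x f)); first by apply: CP; exists f.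
  by left; rewrite /literal fC inE.
apply: (@der_impR _ _ x f Bot); first by left; rewrite /literal (negbTE fC) inE.
apply: (@der_ax (Lab x f)); first by left; rewrite inE.
right; right; apply: CQ; exists f => //.
by rewrite inE fC lL // inE eqxx.
Qed.

Lemma der_disjL x l P Q : P (Lab x (disjs l)) ->
  (forall h, h \in l -> der (plus [:: Lab x h] P) Q) -> der P Q.
Proof.
elim: l P => [|h l IHl] P PA H; first exact: der_bot PA.
apply: (der_orL PA); first by apply: H; rewrite inE eqxx.
apply: IHl => [|k kl]; first by left; rewrite inE.
apply: der_weaken (H k _) _ _ => //; first by rewrite inE kl orbT.
by move=> A [Ak|PA']; [left | right; right].
Qed.

Lemma der_disjR x l h P Q : Q (Lab x (disjs l)) -> h \in l ->
  der P (plus [:: Lab x h] Q) -> der P Q.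
Proof.
elim: l Q => [|k l IHl] Q QA //; rewrite inE => hl d.
apply: (der_orR QA); case/orP: hl => [/eqP hk|hl].
  apply: der_weaken d _ _ => // A [|QA']; last by right.
  by rewrite inE => /eqP ->; left; rewrite hk inE eqxx.
apply: (IHl _ _ hl); first by left; rewrite !inE eqxx orbT.
by apply: der_weaken d _ _ => // A [Ah|QA']; [left | right; right].
Qed.

(** * Completeness for boxes *)

Section Box.
Context (g : formula) (a0 : program).
Context (gL : Box a0 g \in L) (testsP : forall f, f \in tests a0 -> truth f).

Fixpoint run_spine (s : seq program) w v : Prop :=
  if s is a :: s' then exists2 u, @run canonical a w u & run_spine s' u v
  else w = v.

Definition safe s w : Prop := forall v, run_spine s w v -> g \in world_set v.

(** The formula [A(s)]. Being a safe world is made boolean classically, to filter the finitely many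
    subsets of [L]. *)
Definition invariant s : formula :=
  disjs [seq char_formula C | C <- enum_fset (fpowerset L) &
                             `[< exists2 w, world_set w = C & safe s w >]].

Lemma der_invariantL x s P Q : P (Lab x (invariant s)) ->
  (forall w, safe s w -> der (join (pos_part x w) P) (join (neg_part x w) Q)) ->
  der P Q.
Proof.
move=> PA H; apply: (der_disjL PA) => h /mapP [C].
rewrite mem_filter => /andP [/asboolP [w <- ws] _] ->.
apply: (@der_charL x w); [exact/fsubsetP/world_sub | by left; rewrite inE |].
by apply: der_weaken (H w ws) _ _ => A [] ?; [left | right; right | left | right].
Qed.

Lemma der_invariantR x s w P Q : safe s w -> Q (Lab x (invariant s)) ->
  (forall A, pos_part x w A -> P A) -> (forall A, neg_part x w A -> Q A) ->
  der P Q.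
Proof.
move=> ws QA wP wQ; apply: (@der_disjR x _ (char_formula w) _ _ QA).
  apply/mapP; exists (world_set w) => //; rewrite mem_filter; apply/andP; split.
    by apply/asboolP; exists w.
  by rewrite fpowersetE; apply/fsubsetP; apply: world_sub.
by apply: (@der_charR x w) => // [|A /wQ]; [left; rewrite inE | right].
Qed.

Lemma invariant_step s s' (b : bool) : s \in spines a0 -> s' \in succ s ->
  derivable (step_context invariant s b, [fset Lab (next_label s b) (invariant s')]).
Proof.
move=> sa ss'; apply: der_derivable.
have PA : Lab b (invariant s) \in step_context invariant s b.
  by case: s {sa ss'} => [|[] *]; rewrite !inE ?eqxx ?orbT.
apply: (der_invariantL PA) => w ws.
(* If the label stays and [w] is safe for [s'] too, then [w] itself is a disjunct of the new
   invariant. *)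
have other : next_label s b = b -> safe s' w ->
    der (join (pos_part b w) (fun A => A \in step_context invariant s b))
        (join (neg_part b w) (fun A => A \in [fset Lab (next_label s b) (invariant s')])).
  move=> -> ws'; apply: (@der_invariantR b s' w) => //; try by left.
  by right; rewrite inE.
have := spines_tests sa; case: s sa ss' ws PA other => [|a s] // sa ss' ws PA other tst.
case: a sa ss' ws PA other tst => [n|c d|c d|f|c] sa; rewrite /= !inE.
(* Atomic head: an inconsistent partition at the new label is derivable, an accessible world is safe
   for the rest, and any other partition misses some [f] boxed in [w], so the left box rule closes
   it. *)
- move=> /eqP -> ws _ _ _; apply: (@der_cases (nat_of_bool (~~ b))) => C CL.
  have [Cc|nC] := pselect (consistent C); last first.
    by apply: der_weaken (inconsistent_der (nat_of_bool (~~ b)) CL nC) _ _ => A ?; left.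
  pose u : world := exist _ C Cc.
  have [wu|nwu] := pselect (forall f, Box (Atm n) f \in world_set w -> f \in C).
    apply: (@der_invariantR (nat_of_bool (~~ b)) s u) => //; try by left.
      by move=> v uv; apply: ws; exists u.
    by right; right; rewrite inE.
  have [f [fw fC]] : exists f, Box (Atm n) f \in world_set w /\ f \notin C.
    apply: contrapT => no_f; apply: nwu => f fw; apply: contrapT => /negP fC.
    by apply: no_f; exists f.
  apply: (@der_boxL _ _ (nat_of_bool b) n (nat_of_bool (~~ b)) f).
  + by right; left; exists (Box (Atm n) f).
  + by right; right; rewrite !inE eqxx.
  apply: (@der_ax (Lab (nat_of_bool (~~ b)) f)); first by left; rewrite inE.
  left; exists f => //; rewrite inE fC /=.
  by apply: (Lclosed (world_sub fw)); rewrite inE eqxx.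
- move=> /eqP -> ws _ other _; apply: other => // v /= [u1 r1 [u2 r2 r3]].
  by apply: ws; exists u2 => //; exists u1.
- move=> /orP [] /eqP -> ws _ other _; apply: other => // v [u r1 r2];
  by apply: ws; exists u => //; first [by left | by right].
(* Test head: if [f] is in [w], it is true there and the run stays at [w]; otherwise [f] is on both
   sides, the right test rule having put it in the antecedent. *)
- move=> /eqP -> ws _ other tst.
  have fa : f \in tests a0 by apply: (tst (Test f)); rewrite !inE eqxx.
  have fL := tests_closed gL fa.
  case: (boolP (f \in world_set w)) => fw.
    apply: other => // v r; apply: ws; exists w => //; split=> //.
    by apply/(testsP fa).
  apply: (@der_ax (Lab (nat_of_bool b) f)); first by right; rewrite !inE eqxx.
  by left; exists f => //; rewrite inE fw.
- move=> /orP [] /eqP -> ws _ other _; apply: other => // v.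
    by move=> r; apply: ws; exists w => //; apply: rt_refl.
  move=> [u1 r1 [u2 r2 r3]]; apply: ws; exists u2 => //.
  by apply: rt_trans r2; apply: rt_step.
Qed.

(** Were the box missing from [w], a cut on the invariant of [[:: a0]] would derive the sequent of
    [w]: by assumption [w] is one of the disjuncts, and the graph of spines derives the box from the
    invariant. *)
Lemma box_complete w :
  (forall v, @run canonical a0 w v -> g \in world_set v) ->
  Box a0 g \in world_set w.
Proof.
move=> ws; apply: contrapT => /negP not_w; apply: (@world_der w).
apply: (@der_cut _ _ (Lab 0 (invariant [:: a0]))).
  apply: (@der_invariantR 0 [:: a0] w).
  - by move=> v [u r <-]; apply: ws.
  - by left; rewrite inE.
  - by [].
  - by move=> A; right.
have final (b : bool) : derivable ([fset Lab b (invariant [::])], [fset Lab b g]).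
  apply: der_derivable; apply: (@der_invariantL (nat_of_bool b) [::]).
    by rewrite inE.
  move=> u us; apply: (@der_ax (Lab (nat_of_bool b) g)); last by right; rewrite inE.
  by left; exists g => //; apply: us.
apply: (derivable_der (invariant_box invariant_step final false)) => A;
rewrite inE => /eqP ->.
  by left; rewrite inE.
by exists (Box a0 g); rewrite // inE not_w.
Qed.
End Box.

(** * Soundness for boxes and the truth lemma *)

Lemma box_sound a g w v : (forall f, f \in tests a -> truth f) ->
  Box a g \in L -> Box a g \in world_set w -> @run canonical a w v ->
  g \in world_set v.
Proof.
have entails1 u h k : h \in L -> k \in world_set u ->
    der (fun A => A \in [:: Lab 0 k]) (fun A => A \in [:: Lab 0 h]) ->
    h \in world_set u.
  move=> hL ku d; case: (@world_entails u [:: k] [:: h] d) => [f|f|f];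
  by rewrite inE => /eqP ->.
elim: a g w v => [n|b IHb c IHc|b IHb c IHc|f|b IHb] g w v tP gL gw.
- exact.
- case=> u rb rc.
  have bL : Box b (Box c g) \in L by apply: (Lclosed gL); rewrite !inE eqxx orbT.
  have cL : Box c g \in L by apply: (Lclosed bL); rewrite inE eqxx.
  apply: (IHc _ u) => //; first by move=> f fc; apply: tP; rewrite mem_cat fc orbT.
  apply: (IHb _ w) => //; first by move=> f fb; apply: tP; rewrite mem_cat fb.
  apply: (entails1 _ _ _ bL gw); apply: der_seqL; first by rewrite ?inE ?eqxx.
  by apply: (@der_ax (Lab 0 (Box b (Box c g)))); [left; rewrite inE | rewrite inE].
- have bL : Box b g \in L by apply: (Lclosed gL); rewrite !inE eqxx orbT.
  have cL : Box c g \in L by apply: (Lclosed gL); rewrite !inE eqxx !orbT.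
  case=> r.
    apply: (IHb _ w) => //; first by move=> f fb; apply: tP; rewrite mem_cat fb.
    apply: (entails1 _ _ _ bL gw); apply: der_cupL; first by rewrite ?inE ?eqxx.
    by apply: (@der_ax (Lab 0 (Box b g))); [left; rewrite !inE eqxx | rewrite inE].
  apply: (IHc _ w) => //; first by move=> f fc; apply: tP; rewrite mem_cat fc orbT.
  apply: (entails1 _ _ _ cL gw); apply: der_cupL; first by rewrite ?inE ?eqxx.
  by apply: (@der_ax (Lab 0 (Box c g))); [left; rewrite !inE eqxx orbT | rewrite inE].
- case=> <- /(tP f); rewrite inE eqxx => /(_ isT) fw.
  have gL' : g \in L by apply: (Lclosed gL); rewrite inE eqxx.
  case: (@world_entails w [:: f; Box (Test f) g] [:: g]) => [||h|h].
  + apply: (@der_testL _ _ 0 f g); first by rewrite !inE eqxx orbT.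
      by apply: (@der_ax (Lab 0 f)); [rewrite !inE eqxx | left; rewrite inE].
    by apply: (@der_ax (Lab 0 g)); [left; rewrite inE | rewrite inE].
  + by move=> h; rewrite !inE => /orP [] /eqP ->.
  + by rewrite inE => /eqP ->.
  + by rewrite inE => /eqP ->.
- have bL : Box b (Box (Star b) g) \in L by apply: (Lclosed gL); rewrite !inE eqxx orbT.
  have gL' : g \in L by apply: (Lclosed gL); rewrite inE eqxx.
  (* The starred box is carried along every run of [b] and unfolds to [g] at the end. *)
  move=> r; have: Box (Star b) g \in world_set v.
    elim: r gw => {w v} [w v r gw|//|w v u _ IH1 _ IH2 /IH1 /IH2 //].
    apply: (IHb _ w) => //; apply: (entails1 _ _ _ bL gw).
    apply: der_starL; first by rewrite ?inE ?eqxx.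
    apply: (@der_ax (Lab 0 (Box b (Box (Star b) g)))); last by rewrite inE.
    by left; rewrite !inE eqxx orbT.
  move=> gv; apply: (entails1 _ _ _ gL' gv).
  apply: der_starL; first by rewrite ?inE ?eqxx.
  by apply: (@der_ax (Lab 0 g)); [left; rewrite !inE eqxx | rewrite inE].
Qed.

(** Both box lemmas need the truth of the tests of the program, so formulas and programs are treated
    in one induction. *)
Lemma truth_lemma :
  (forall f, f \in L -> truth f) /\
  (forall a, forall f, f \in tests a -> f \in L -> truth f).
Proof.
have in1 (h k : formula) : h \in [:: k] -> h = k by rewrite inE => /eqP.
apply: formula_program_ind => //=.
- move=> L0 w; split=> // w_bot; case: (@world_der w).
  by apply: (@der_bot 0); exists Bot.
- move=> f IHf g IHg fgL w.
  have fL : f \in L by apply: (Lclosed fgL); rewrite !inE eqxx.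
  have gL : g \in L by apply: (Lclosed fgL); rewrite !inE eqxx orbT.
  have /= -> := IHf fL w; have /= -> := IHg gL w; split=> [[fw gw]|fgw].
    case: (@world_entails w [:: f; g] [:: And f g]) => [||h|h].
    + apply: der_andR; first by rewrite ?inE ?eqxx.
        by apply: (@der_ax (Lab 0 f)); [rewrite !inE eqxx | left; rewrite inE].
      by apply: (@der_ax (Lab 0 g)); [rewrite !inE eqxx orbT | left; rewrite inE].
    + by move=> h; rewrite !inE => /orP [] /eqP ->.
    + by move/in1 ->.
    + by move/in1 ->.
  split.
    case: (@world_entails w [:: And f g] [:: f]) => [|h|h|h]; try by move/in1 ->.
    apply: der_andL; first by rewrite ?inE ?eqxx.
    by apply: (@der_ax (Lab 0 f)); [left; rewrite !inE eqxx | rewrite inE].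
  case: (@world_entails w [:: And f g] [:: g]) => [|h|h|h]; try by move/in1 ->.
  apply: der_andL; first by rewrite ?inE ?eqxx.
  by apply: (@der_ax (Lab 0 g)); [left; rewrite !inE eqxx orbT | rewrite inE].
- move=> f IHf g IHg fgL w.
  have fL : f \in L by apply: (Lclosed fgL); rewrite !inE eqxx.
  have gL : g \in L by apply: (Lclosed fgL); rewrite !inE eqxx orbT.
  have /= -> := IHf fL w; have /= -> := IHg gL w; split=> [|fgw].
    case=> kw.
      case: (@world_entails w [:: f] [:: Or f g]) => [|h|h|h]; try by move/in1 ->.
      apply: der_orR; first by rewrite ?inE ?eqxx.
      by apply: (@der_ax (Lab 0 f)); [rewrite inE | left; rewrite !inE eqxx].
    case: (@world_entails w [:: g] [:: Or f g]) => [|h|h|h]; try by move/in1 ->.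
    apply: der_orR; first by rewrite ?inE ?eqxx.
    by apply: (@der_ax (Lab 0 g)); [rewrite inE | left; rewrite !inE eqxx orbT].
  case: (@world_entails w [:: Or f g] [:: f; g]) => [|h|h|h].
  + apply: der_orL; first by rewrite ?inE ?eqxx.
      by apply: (@der_ax (Lab 0 f)); [left; rewrite inE | rewrite !inE eqxx].
    by apply: (@der_ax (Lab 0 g)); [left; rewrite inE | rewrite !inE eqxx orbT].
  + by move/in1 ->.
  + by rewrite !inE => /orP [] /eqP ->.
  + by rewrite !inE => /orP [] /eqP ->; [left | right].
- move=> f IHf g IHg fgL w.
  have fL : f \in L by apply: (Lclosed fgL); rewrite !inE eqxx.
  have gL : g \in L by apply: (Lclosed fgL); rewrite !inE eqxx orbT.
  have /= -> := IHf fL w; have /= -> := IHg gL w; split=> [fg|fgw fw].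
    (* Excluded middle: [f] and [Imp f g] together form a derivable succedent, so [w] contains one
       of them; from [f] the assumption gives [g]. *)
    case: (@world_entails w [::] [:: f; Imp f g]) => [|//|h|h].
    + apply: (@der_impR _ _ 0 f g); first by rewrite !inE eqxx orbT.
      by apply: (@der_ax (Lab 0 f)); [left; rewrite inE | right; rewrite !inE eqxx].
    + by rewrite !inE => /orP [] /eqP ->.
    rewrite !inE => /orP [] /eqP -> // /fg gw.
    case: (@world_entails w [:: g] [:: Imp f g]) => [|k|k|k]; try by move/in1 ->.
    apply: der_impR; first by rewrite ?inE ?eqxx.
    by apply: (@der_ax (Lab 0 g)); [right; rewrite inE | left; rewrite inE].
  case: (@world_entails w [:: f; Imp f g] [:: g]) => [|h|h|h].
  + apply: (@der_impL _ _ 0 f g); first by rewrite !inE eqxx orbT.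
      by apply: (@der_ax (Lab 0 f)); [rewrite !inE eqxx | left; rewrite inE].
    by apply: (@der_ax (Lab 0 g)); [left; rewrite inE | rewrite inE].
  + by rewrite !inE => /orP [] /eqP ->.
  + by move/in1 ->.
  + by move/in1 ->.
- move=> a IHa g IHg agL w.
  have gL : g \in L by apply: (Lclosed agL); rewrite inE eqxx.
  have tP f : f \in tests a -> truth f.
    by move=> fa; apply: IHa => //; apply: tests_closed agL _ fa.
  split=> [H|agw v r]; last by apply/IHg => //; apply: box_sound agL agw r.
  by apply: box_complete => // v r; apply/IHg => //; apply: H.
- move=> b IHb c IHc f; rewrite mem_cat => /orP [/IHb|/IHc]; exact.
- move=> b IHb c IHc f; rewrite mem_cat => /orP [/IHb|/IHc]; exact.
- by move=> f IHf h /in1 ->.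
Qed.

(** Splitting at [x] leaves inconsistent partitions, which are derivable, and worlds, which contain
    [f] by the truth lemma. *)
Lemma valid_der f x : f \in L -> valid f ->
  der (fun _ => False) (fun A => A = Lab x f).
Proof.
move=> fL fV; apply: (@der_cases x) => C CL.
have [Cc|nC] := pselect (consistent C); last first.
  by apply: der_weaken (inconsistent_der x CL nC) _ _ => A ?; left.
apply: (@der_ax (Lab x f)); last by right.
left; exists f => //.
by apply/(truth_lemma.1 f fL (exist _ C Cc)); apply: fV.
Qed.

End Canonical.

Theorem theorem3 (f : formula) (x : nat) :
  valid f -> G3PDL_omega_derivable (fset0, [fset Lab x f]).
Proof.
move=> fV; apply/omega_derivable/der_derivable.
have closedL h : h \in [fset k in closure f] -> {subset children h <= [fset k in closure f]}.
  by rewrite inE => hf k /(closure_closed.1 f h hf); rewrite inE.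
have fL : f \in [fset k in closure f] by rewrite inE closure_self.
by apply: der_weaken (valid_der closedL x fL fV) _ _ => A // ->; rewrite inE.
Qed.
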